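(* Let $R$ be a commutative ring which either satisfies $SR_2$ or is a Dedekind domain of arithmetic type. Then for every $n\geq 2$ the Tits complex $\mathcal{T}_n(R)$ is Cohen–Macaulay of dimension $n-2$. In particular, $\mathcal{T}_n(R)$ is $(n-3)$-connected.
   Context: All rings are commutative with $1$. A flag in $R^n$ is a chain $0\subsetneq V_1\subsetneq\cdots\subsetneq V_k\subsetneq R^n$ of free direct summands of $R^n$; it is complete if $k=n-1$ (so $\operatorname{rk}V_i=i$), and it is good if it is a subflag of some complete flag. The Tits complex $\mathcal{T}_n(R)$ is the simplicial complex whose vertices are the direct summands $V$ of $R^n$ with $0\neq V\neq R^n$ such that both $V$ and $R^n/V$ are free, and which has a $k$-simplex for every good flag $0\subsetneq V_0\subsetneq\cdots\subsetneq V_k\subsetneq R^n$. (Equivalently, $\mathcal{T}_n(R)$ is the nerve of the poset of such summands, where $V<W$ iff $V\subsetneq W$ and $W/V$ is free.) A simplicial complex $X$ is $d$-spherical if it is $d$-dimensional and $(d-1)$-connected (with $(-1)$-connected meaning nonempty); $X$ is Cohen–Macaulay of dimension $d$ if it is $d$-spherical and, for every $k$-simplex $\sigma$, the link $\operatorname{lk}\sigma$ is $(d-k-1)$-spherical. A ring $R$ satisfies $SR_2$ if whenever $a,b\in R$ generate the unit ideal there is $t\in R$ with $a-tb\in R^\times$. For a number field $K$ with set of places $\Omega$ and set of infinite (archimedean) places $S_\infty$, and a finite set $S\subseteq\Omega$ with $S_\infty\subseteq S$, the Dedekind domain of arithmetic type is $\mathcal{O}_S=\{x\in K: |x|_v\le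 1\text{ for all }v\in\Omega\setminus S\}$. *)

(* Defs.v *)
From HB Require Import structures.
From mathcomp Require Import all_boot all_order all_algebra all_field.
From mathcomp Require Import all_classical all_reals all_analysis.
From mathcomp Require Import Rstruct Rstruct_topology.
Set Implicit Arguments. Unset Strict Implicit. Unset Printing Implicit Defensive.
Import Order.TTheory GRing.Theory Num.Theory.
Local Open Scope classical_set_scope.
Local Open Scope ring_scope.

Notation RR := Rdefinitions.R.

Definition is_unit (R : comNzRingType) (x : R) : Prop := exists y : R, x * y = 1.

Definition SR2 (R : comNzRingType) : Prop :=
  forall a b : R, (exists u v : R, u * a + v * b = 1) ->
    exists t : R, is_unit (a - t * b).

Definition absolute_value (K : fieldType) (f : K -> RR) : Prop :=
  [/\ forall x, 0 <= f x,
      forall x, f x = 0 <-> x = 0,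
      forall x y, f (x * y) = f x * f y &
      forall x y, f (x + y) <= f x + f y].

Definition nontrivial_av (K : fieldType) (f : K -> RR) : Prop :=
  absolute_value f /\ exists x : K, x != 0 /\ f x <> 1.

Definition equiv_av (K : fieldType) (f g : K -> RR) : Prop :=
  exists c : RR, 0 < c /\ forall x, g x = powR (f x) c.

Definition archimedean_av (K : fieldType) (f : K -> RR) : Prop :=
  ~ (forall x y, f (x + y) <= Num.max (f x) (f y)).

(* A place of K is an equivalence class of nontrivial absolute values.
   A finite set S of places is given by finitely many representatives
   s : 'I_m -> (K -> RR); a place v lies in S iff v is equivalent to some s i. *)
Definition in_places (K : fieldType) (m : nat) (s : 'I_m -> K -> RR)
    (v : K -> RR) : Prop :=
  exists i, equiv_av (s i) v.

Definition O_S (K : fieldType) (m : nat) (s : 'I_m -> K -> RR) : set K :=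
  [set x | forall v : K -> RR, nontrivial_av v -> ~ in_places s v -> v x <= 1].

Definition arithmetic_dedekind (R : comNzRingType) : Prop :=
  exists (K : fieldExtType rat) (m : nat) (s : 'I_m -> K -> RR) (phi : R -> K),
    [/\ (forall i, nontrivial_av (s i)),
        (forall v : K -> RR, nontrivial_av v -> archimedean_av v -> in_places s v),
        (forall a b, phi (a + b) = phi a + phi b /\ phi (a * b) = phi a * phi b),
        phi 1 = 1 /\ injective phi &
        forall x : K, O_S s x <-> exists a, phi a = x].

Section Modules.
Variables (R : comNzRingType) (n : nat).
Local Notation M := 'rV[R]_n.

Definition submodule (V : set M) : Prop :=
  [/\ V 0, forall u v, V u -> V v -> V (u + v) &
      forall (a : R) v, V v -> V (a *: v)].

Definition free_rank (V : set M) (r : nat) : Prop :=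
  exists b : 'I_r -> M,
    (forall v, V v <-> exists c : 'I_r -> R, v = \sum_(i < r) c i *: b i) /\
    (forall c : 'I_r -> R, \sum_(i < r) c i *: b i = 0 -> forall i, c i = 0).

Definition free (V : set M) : Prop := exists r, free_rank V r.

Definition complement (V W : set M) : Prop :=
  [/\ submodule V, submodule W,
      (forall x, V x -> W x -> x = 0) &
      (forall x : M, exists u v, [/\ V u, W v & x = u + v])].

Definition direct_summand (V : set M) : Prop := exists W, complement V W.

(* Vertices of the Tits complex: summands V, 0 <> V <> R^n, with V and
   R^n/V free.  (R^n/V is isomorphic to any complement W of V.) *)
Definition tits_vertex (V : set M) : Prop :=
  [/\ V <> [set 0], V <> setT, free V &
      exists W, complement V W /\ free W].

Definition complete_flag (F : 'I_n.-1 -> set M) : Prop :=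
  [/\ forall i, free (F i) /\ direct_summand (F i),
      (forall i, F i <> [set 0] /\ F i <> setT) &
      forall i j : 'I_n.-1, (i < j)%N -> F i `<` F j].

Definition tits_complex : set (set (set M)) :=
  [set sigma | [/\ sigma !=set0, finite_set sigma,
     sigma `<=` tits_vertex &
     exists F, complete_flag F /\ sigma `<=` range F]].

End Modules.

Arguments tits_complex : clear implicits.

(* A simplicial complex on vertex type T is given by its set of simplices
   (nonempty finite subsets of T). *)

Section Complexes.
Variable T : Type.
Implicit Types (X : set (set T)).

(* dim X = d  (d = -1 for the empty complex) *)
Definition dimension X (d : int) : Prop :=
  (forall sigma, X sigma -> exists k : nat, (sigma #= `I_k)%card /\ (k%:Z <= d + 1)) /\
  (d = -1 \/ exists sigma, X sigma /\ exists k : nat, (sigma #= `I_k)%card /\ k%:Z = d + 1).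

(* Points of the geometric realization |X|: barycentric coordinates. *)
Definition realization X (alpha : T -> RR) : Prop :=
  (forall t, 0 <= alpha t) /\
  exists m (e : 'I_m -> T), [/\ injective e,
     [set t | alpha t != 0] = range e, X (range e) &
     \sum_(i < m) alpha (e i) = 1].

(* Continuous maps from a compact subset D of R^k into |X|: the image lies
   in a finite subcomplex and the barycentric coordinates are continuous.
   (For compact D this is exactly continuity for the weak topology.) *)
Definition cont_map X (k : nat) (D : set 'rV[RR]_k) (f : 'rV[RR]_k -> T -> RR) : Prop :=
  [/\ forall x, D x -> realization X (f x),
      (exists m (e : 'I_m -> T), forall x, D x -> [set t | f x t != 0] `<=` range e) &
      forall t, {within D, continuous (fun x => f x t)}].

Definition sphereR (k : nat) : set 'rV[RR]_k.+1 :=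
  [set x | \sum_(i < k.+1) x ord0 i ^+ 2 = 1].
Definition diskR (k : nat) : set 'rV[RR]_k.+1 :=
  [set x | \sum_(i < k.+1) x ord0 i ^+ 2 <= 1].

Arguments sphereR : clear implicits.
Arguments diskR : clear implicits.

Definition connected_upto X (m : int) : Prop :=
  ((-1 <= m) -> exists alpha, realization X alpha) /\
  forall k : nat, k%:Z <= m ->
    forall f, cont_map X (sphereR k) f ->
      exists g, cont_map X (diskR k) g /\ forall x, sphereR k x -> g x = f x.

Definition spherical X (d : int) : Prop :=
  dimension X d /\ connected_upto X (d - 1).

Definition link X (sigma : set T) : set (set T) :=
  [set tau | [/\ X tau, tau `&` sigma = set0 & X (tau `|` sigma)]].

Definition cohen_macaulay X (d : int) : Prop :=
  spherical X d /\
  forall (k : nat) sigma, X sigma -> (sigma #= `I_k.+1)%card ->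
    spherical (link X sigma) (d - k%:Z - 1).

End Complexes.

(* Main.v *)
(** Both hypotheses imply Bass' condition SR3: for [(a, b, c)] unimodular there
    are [s, t] with [(a + s c, b + t c)] unimodular. For subrings of number fields
    this holds because [R / b] is zero-dimensional for [b <> 0]. Under SR3 stably
    free modules are free, so the Tits complex is the order complex of the poset
    of proper nonzero submodules with free quotient, and links are joins of open
    intervals of this poset.

    Let [V1 / V0] be free of rank [m], [f] a functional and [I] an ideal
    containing [f(V0)] with [f(V1) + I = R]. By induction on [m], the poset of all
    [W] strictly between [V0] and [V1] with [f(W) + I = R] is [(m-3)]-connected
    ([I = R] gives the whole interval). By SR3, [f] may be taken to be surjective
    and zero on [V0]. Pick a second functional [g], independent of [f], with kernel
    [K]. The [W] with [f(W) = R] which either lie in [K] or on which [(f, g)] is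
    onto [R^2] form a conically contractible poset, through
    [W >= W /\ K <= K]. The other [W] with [f(W) = R], and then the other [W] with
    [f(W) + I = R], are attached in order of increasing rank; the link of [W] is
    the join of a poset of the same kind below [W] and one above [W], the ideal for
    the latter being the image of [W] under a functional.

    Topologically, attaching independent vertices along [(m-1)]-connected links
    preserves [m]-connectedness: a map from the boundary of a cube is pushed off
    the new vertices cell by cell on a fine grid. *)
Require Import Defs.
From HB Require Import structures.
From mathcomp Require Import all_boot all_order all_algebra all_field.
From mathcomp Require Import finmap.
From mathcomp Require Import all_classical all_reals all_analysis.
From mathcomp Require Import Rstruct Rstruct_topology.
From mathcomp Require Import zify ring lra.
Set Implicit Arguments. Unset Strict Implicit. Unset Printing Implicit Defensive.
Import Order.TTheory GRing.Theory Num.Theory numFieldNormedType.Exports.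
Local Open Scope classical_set_scope.
Local Open Scope ring_scope.

(** * Combinatorial certificates of connectedness *)

(** Bare intervals do not allow an induction: among the members above an attached [W], only those on
    which the pair of functionals is onto are present, and this depends on [W]. Stating the claim
    for a functional modulo an ideal turns that condition into one of the same shape. The bound is
    consistent because ranks add: if [W] has rank [r] over [V0] and [V1] has rank [t] over [W], the
    two halves of the link are [(r-3)]- and [(t-3)]-connected by induction, and their join is
    [(r+t-4)]-connected, one less than the claim for rank [r+t], as attaching requires.

    SR3 enters through its form for longer columns, in two ways: it completes a unimodular column to
    an invertible matrix, so kernels of surjective functionals are free; and it replaces a
    functional that is onto modulo [I] by one that is onto.

    On the topological side, boxes are used instead of balls because the boundary of a box
    subdivides into boxes of smaller dimension. *)

Section BuildConn.
Variables (T : Type) (e : T -> T -> Prop).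
Hypothesis esym : forall u v, e u v -> e v u.
Implicit Types (A B S N : set T) (m : int).

(* A certificate that the flag complex of [e] on [S] is [m]-connected: joins are
   treated by induction on certificates rather than topologically. *)
Inductive conn : int -> set T -> Prop :=
| conn_void m S : m <= -2 -> conn m S
| conn_cone m S v : S v -> (forall u, S u -> e v u) -> conn m S
| conn_attach m A N S :
    conn m A -> S = A `|` N ->
    (forall v, N v -> ~ A v) ->
    (forall u v, N u -> N v -> e u v -> u = v) ->
    (forall v, N v -> conn (m - 1) [set u | A u /\ e v u]) ->
    conn m S.

Lemma conn_le m m' S : conn m S -> m' <= m -> conn m' S.
Proof.
move=> h; elim: h m' => {m S}.
- by move=> m S hm m' hm'; apply: conn_void; apply: le_trans hm' hm.
- by move=> m S v Sv hv m' _; apply: (conn_cone _ Sv hv).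
- move=> m A N S _ IHA SE disj indep _ IHl m' hm'.
  apply: (conn_attach (IHA _ hm') SE) => // v Nv.
  by apply: IHl => //; rewrite lerB.
Qed.

(** Vertices of equal rank are pairwise non-adjacent, so each rank is one [conn_attach]; when [v]
    arrives, its link consists of its neighbours in [A] or of smaller rank. *)
Lemma conn_attach_ranked m A S (rho : T -> nat) (b : nat) :
  conn m A -> A `<=` S ->
  (forall v, S v -> ~ A v -> (rho v < b)%N) ->
  (forall u v, S u -> S v -> ~ A u -> ~ A v -> e u v -> rho u = rho v -> u = v) ->
  (forall v, S v -> ~ A v ->
     conn (m - 1) [set u | [/\ S u, e v u & A u \/ (rho u < rho v)%N]]) ->
  conn m S.
Proof.
move=> cA AS rb rinj cl.
have step j : conn m [set u | S u /\ (A u \/ (rho u < j)%N)].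
  elim: j => [|j IH].
    rewrite (_ : [set u | _] = A) //; apply/seteqP; split=> u /=.
      by case=> _ [].
    by move=> Au; split; [exact: AS|left].
  apply: (@conn_attach _ _ [set u | [/\ S u, ~ A u & rho u = j]] _ IH).
  - apply/seteqP; split=> u /=.
      case=> Su [Au|]; first by left; split=> //; left.
      rewrite ltnS leq_eqVlt => /orP[/eqP ru|ru]; last by left; split=> //; right.
      have [Au|Au] := pselect (A u); last by right.
      by left; split=> //; left.
    case=> [[Su [Au|ru]]|[Su Au ru]]; split=> //; first by left.
      by right; apply: ltnW.
    by right; rewrite ru.
  - by move=> v [Sv nAv rv] /= [_ [//|]]; rewrite rv ltnn.
  - move=> u v [Su nAu ru] [Sv nAv rv] euv; apply: rinj => //.
    by rewrite ru rv.
  - move=> v [Sv nAv rv]; move: (cl v Sv nAv).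
    congr (conn _ _); apply/seteqP; split=> u /=.
      by case=> Su evu [Au|ru]; split=> //; split=> //; [left|right; rewrite -rv].
    by case=> [[Su [Au|ru]] evu]; split=> //; [left|right; rewrite rv].
rewrite (_ : S = [set u | S u /\ (A u \/ (rho u < b)%N)]) //.
apply/seteqP; split=> u /=; last by case.
by move=> Su; split=> //; have [Au|Au] := pselect (A u); [left|right; apply: rb].
Qed.

(** A void certificate for [A] gives nothing to induct on, so [A] is rebuilt on top of [B] in order
    of [rho]: the link of [v] is the join of [B] with a part of [A] whose ranks have a smaller
    bound, hence again [b]-connected. *)
Lemma conn_join_any A B b (rho : T -> nat) (N : nat) :
  (forall u, A u -> (rho u < N)%N) ->
  (forall u v, A u -> A v -> e u v -> rho u = rho v -> u = v) ->
  (forall u v, A u -> B v -> e u v) ->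
  (forall u, A u -> ~ B u) ->
  conn b B -> conn b (A `|` B).
Proof.
elim: N A => [|N IH] A rN rinj AB disj cB.
  rewrite (_ : A `|` B = B) //; apply/seteqP; split=> u; last by right.
  by case=> // /rN.
apply: (@conn_attach_ranked _ B _ rho N.+1) => //.
- by move=> v; case=> // /rN.
- by move=> u v [Au|Bu] [Av|Bv] nu nv //; apply: rinj.
move=> v [Av|Bv] nBv //.
have -> : [set u | [/\ (A `|` B) u, e v u & B u \/ (rho u < rho v)%N]] =
    [set u | [/\ A u, e v u & (rho u < rho v)%N]] `|` B.
  apply/seteqP; split=> u /=.
    case=> [[Au|Bu]] evu; last by right.
    by case=> [Bu|ru]; [right|left].
  case=> [[Au evu ru]|Bu]; split=> //; [by left|by right|by right| |by left].
  exact: AB.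
apply: (@conn_le b); last by rewrite lerBlDr lerDl.
apply: IH => //.
- by move=> u [Au _ ru]; have := rN _ Av; move: ru; lia.
- by move=> u w [Au _ _] [Aw _ _]; apply: rinj.
- by move=> u w [Au _ _]; apply: AB.
- by move=> u [Au _ _]; apply: disj.
Qed.

(** The link of a vertex attached to [A] becomes the join of its old link with [B], where the old
    link is one degree less connected. The rank [rho] is there for the void certificates. *)
Lemma conn_join a b A B (rho : T -> nat) (N : nat) :
  (forall u, A u -> (rho u < N)%N) ->
  (forall u v, A u -> A v -> e u v -> rho u = rho v -> u = v) ->
  (forall u v, A u -> B v -> e u v) ->
  (forall u, A u -> ~ B u) ->
  conn a A -> conn b B -> conn (a + b + 2) (A `|` B).
Proof.
move=> rN rinj AB disj cA cB; elim: cA rN rinj AB disj => {a A}.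
- move=> a A ha rN rinj AB disj; apply: (@conn_le b); last by lia.
  exact: conn_join_any rN rinj AB disj cB.
- move=> a A v Av hv rN rinj AB disj; apply: (@conn_cone _ _ v); first by left.
  by move=> u [/hv//|]; apply: AB.
- move=> a A M S cA IHA SE disjM indep cl IHl rN rinj AB disj; subst S.
  apply: (@conn_attach _ (A `|` B) M); first apply: IHA.
  + by move=> u Au; apply: rN; left.
  + by move=> u v Au Av; apply: rinj; left.
  + by move=> u v Au Bv; apply: AB => //; left.
  + by move=> u Au; apply: disj; left.
  + by rewrite setUAC.
  + by move=> v Mv [/(disjM v Mv)//|]; apply: disj; right.
  + exact: indep.
  + move=> v Mv.
    have -> : [set u | (A `|` B) u /\ e v u] = [set u | A u /\ e v u] `|` B.
      apply/seteqP; split=> u /=; first by case=> [[Au|Bu]] evu; [left|right].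
      case=> [[Au evu]|Bu]; first by split=> //; left.
      by split; [right|apply: AB => //; right].
    have -> : a + b + 2 - 1 = a - 1 + b + 2 by lia.
    apply: IHl => //.
    * by move=> u [Au _]; apply: rN; left.
    * by move=> u w [Au _] [Aw _]; apply: rinj; left.
    * by move=> u w [Au _]; apply: AB; left.
    * by move=> u [Au _]; apply: disj; left.
Qed.

End BuildConn.

(** * Continuity on subsets of Euclidean space *)

Section ContinuityOn.
Variable R : realType.

(** Written as a limit along [within D (nbhs x)], so that the rules for limits of sums, products and
    inverses apply directly. *)
Definition cts d (D : set 'rV[R]_d) (f : 'rV[R]_d -> R) : Prop :=
  forall x, D x -> f @ within D (nbhs x) --> f x.

Lemma ctsE d (D : set 'rV[R]_d) f : cts D f <-> {within D, continuous f}.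
Proof. by split=> h; apply/subspace_continuousP. Qed.

Section Algebra.
Variables (d : nat) (D : set 'rV[R]_d).
Implicit Types f g : 'rV[R]_d -> R.

Lemma cts_eq f g : (forall x, D x -> f x = g x) -> cts D f -> cts D g.
Proof.
move=> fg cf x Dx; rewrite -(fg x Dx); apply: cvg_trans (cf x Dx).
apply: near_eq_cvg; rewrite near_withinE; near=> y => Dy; exact: fg.
Unshelve. all: by end_near. Qed.

Lemma cts_cst (k : R) : cts D (fun=> k).
Proof. by move=> x _; exact: cvg_cst. Qed.

Lemma cts_coord i : cts D (fun x => x ord0 i).
Proof.
move=> x _; apply: cvg_within_filter; exact: coord_continuous.
Qed.

Lemma cts_add f g : cts D f -> cts D g -> cts D (fun x => f x + g x).
Proof. by move=> cf cg x Dx; apply: cvgD; [exact: cf|exact: cg]. Qed.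

Lemma cts_mul f g : cts D f -> cts D g -> cts D (fun x => f x * g x).
Proof. by move=> cf cg x Dx; apply: cvgM; [exact: cf|exact: cg]. Qed.

Lemma cts_opp f : cts D f -> cts D (fun x => - f x).
Proof. by move=> cf x Dx; apply: cvgN; exact: cf. Qed.

Lemma cts_sub f g : cts D f -> cts D g -> cts D (fun x => f x - g x).
Proof. by move=> cf cg; apply: cts_add => //; exact: cts_opp. Qed.

Lemma cts_inv f : (forall x, D x -> f x != 0) -> cts D f ->
  cts D (fun x => (f x)^-1).
Proof. by move=> f0 cf x Dx; apply: cvgV; [exact: f0|exact: cf]. Qed.

Lemma cts_norm f : cts D f -> cts D (fun x => `|f x|).
Proof. by move=> cf x Dx; apply: cvg_norm; exact: cf. Qed.

Lemma cts_max f g : cts D f -> cts D g -> cts D (fun x => Num.max (f x) (g x)).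
Proof.
move=> cf cg.
apply: (@cts_eq (fun x => (f x + g x + `|f x - g x|) * 2^-1)).
  by move=> x _; rewrite maxr_absE.
apply: cts_mul; last exact: cts_cst.
by apply: cts_add; [exact: cts_add|apply: cts_norm; exact: cts_sub].
Qed.

Lemma cts_sum (I : Type) (s : seq I) (P : pred I) (F : I -> 'rV[R]_d -> R) :
  (forall i, cts D (F i)) -> cts D (fun x => \sum_(i <- s | P i) F i x).
Proof.
move=> cF; elim: s => [|i s IH].
  apply: (@cts_eq (fun=> 0)); last exact: cts_cst.
  by move=> x _; rewrite big_nil.
apply: (@cts_eq (fun x => (if P i then F i x else 0) + \sum_(j <- s | P j) F j x)).
  by move=> x _; rewrite big_cons; case: ifP => // _; rewrite add0r.
by apply: cts_add => //; case: (P i) => //; exact: cts_cst.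
Qed.

Lemma cts_subset (D' : set 'rV[R]_d) f : D' `<=` D -> cts D f -> cts D' f.
Proof.
move=> DD cf x Dx; apply: cvg_trans (cf x (DD x Dx)).
apply: cvg_app; apply: within_subset; exact: DD.
Qed.

End Algebra.

Lemma ctsU d (A B : set 'rV[R]_d) f :
  closed A -> closed B -> cts A f -> cts B f -> cts (A `|` B) f.
Proof.
move=> cA cB /ctsE fA /ctsE fB; apply/ctsE; exact: withinU_continuous.
Qed.

Lemma cvg_rV d (T : Type) (F : set_system T) (FF : Filter F)
    (r : T -> 'rV[R]_d) (a : 'rV[R]_d) :
  (forall i, (fun y => r y ord0 i) @ F --> a ord0 i) -> r @ F --> a.
Proof.
move=> h A [P /= Pa PA].
have : \forall y \near F, forall i, P ord0 i (r y ord0 i).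
  apply: filter_forall => i; exact: (h i _ (Pa ord0 i)).
apply: filterS => y hy /=; apply: PA => i j; rewrite (ord1 i); exact: hy.
Qed.

Lemma cts_comp d d' (D : set 'rV[R]_d) (D' : set 'rV[R]_d') f
    (r : 'rV[R]_d' -> 'rV[R]_d) :
  (forall x, D' x -> D (r x)) -> (forall i, cts D' (fun x => r x ord0 i)) ->
  cts D f -> cts D' (fun x => f (r x)).
Proof.
move=> rD cr cf x Dx.
have h : r @ within D' (nbhs x) --> r x.
  by apply: cvg_rV => i; exact: cr.
have cr' : r @ within D' (nbhs x) --> within D (nbhs (r x)).
  move=> A hA.
  have hA' : nbhs (r x) [set z | D z -> A z] := hA.
  have : nbhs x [set y | D' y -> D (r y) -> A (r y)] := h _ hA'.
  by apply: filterS => y H D'y; exact: (H D'y (rD _ D'y)).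
exact: (cvg_comp _ _ cr' (cf _ (rD _ Dx))).
Qed.

(** The near-covering form of compactness, for [del] tending to [0] from the right, turns local
    moduli of continuity into a uniform one; the finitely many coordinates in [E] are then handled
    by minima. *)
Lemma cts_unif d (K : set 'rV[R]_d) (T : eqType) (E : seq T)
    (f : 'rV[R]_d -> T -> R) (eps : R) :
  compact K -> (forall t, cts K (f^~ t)) -> 0 < eps ->
  exists2 del, 0 < del & forall x y, K x -> K y ->
    (forall i, `|x ord0 i - y ord0 i| < del) ->
    forall t, t \in E -> `|f x t - f y t| < eps.
Proof.
move=> cK cf e0; elim: E => [|t E [del d0 IH]]; first by exists 1.
suff [del' d'0 H] : exists2 del, 0 < del & forall x y, K x -> K y ->
    (forall i, `|x ord0 i - y ord0 i| < del) -> `|f x t - f y t| < eps.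
  exists (Num.min del del'); first by rewrite lt_min d0.
  move=> x y Kx Ky xy s; rewrite inE => /orP[/eqP->|sE].
    by apply: H => // i; apply: lt_le_trans (xy i) _; rewrite ge_min lexx orbT.
  by apply: IH => // i; apply: lt_le_trans (xy i) _; rewrite ge_min lexx.
have /compact_near_coveringP nc := cK.
have := nc R (0^'+) (fun del x => forall y, K x -> K y ->
    (forall i, `|x ord0 i - y ord0 i| < del) -> `|f x t - f y t| < eps) _.
case.
- move=> x Kx.
  have : \forall y \near within K (nbhs x), `|f x t - f y t| < eps / 2.
    by apply: (@cvgr_dist_lt _ _ _ _ _ _ _ (cf t x Kx)); rewrite divr_gt0.
  rewrite near_withinE => /nbhs_ballP[r /= r0 hr].
  (* Half of the radius is spent on the distance from [x] to [x'], the other half on the distance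
     from [x'] to [y]. *)
  exists (ball x (r / 2), [set del | 0 < del < r / 2]) => /=.
    split; first by apply: nbhsx_ballx; rewrite divr_gt0.
    near=> eta => /=; apply/andP; split; near: eta.
      exact: nbhs_right_gt.
    by apply: nbhs_right_lt; rewrite divr_gt0.
  case=> x' eta /= [xx' /andP[del0 delr]] y Kx' Ky x'y.
  have -> : f x' t - f y t = (f x t - f y t) - (f x t - f x' t) by ring.
  apply: le_lt_trans (ler_normB _ _) _; rewrite [eps]splitr ltrD //.
    apply: hr => //=; split=> // i j; rewrite (ord1 i) /ball /=.
    have := x'y j; have := xx'.2 ord0 j; rewrite /ball /= => h1 h2.
    rewrite (_ : x ord0 j - y ord0 j = (x ord0 j - x' ord0 j) + (x' ord0 j - y ord0 j)); last by ring.
    apply: le_lt_trans (ler_normD _ _) _; rewrite [r]splitr ltrD //.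
    exact: lt_trans h2 delr.
  apply: hr => //=; split=> // i j; apply: (@le_ball _ _ _ (r / 2)); last exact: xx'.2.
  by lra.
  move=> r /= r0 H; exists (r / 2); first by rewrite divr_gt0.
  move=> x y Kx Ky xy; apply: (H (r / 2)) => //=; last by rewrite divr_gt0.
  by rewrite sub0r normrN gtr0_norm ?divr_gt0 //; lra.
Unshelve. all: by end_near. Qed.

End ContinuityOn.

Arguments cts_eq {R d D f g} _ _.
Arguments cts_cst {R d D k}.
Arguments cts_coord {R d D i}.
Arguments cts_add {R d D f g} _ _.
Arguments cts_mul {R d D f g} _ _.
Arguments cts_opp {R d D f} _.
Arguments cts_sub {R d D f g} _ _.
Arguments cts_inv {R d D f} _ _.
Arguments cts_max {R d D f g} _ _.
Arguments cts_norm {R d D f} _.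
Arguments cts_sum {R d D I s P F} _.
Arguments cts_subset {R d D D' f} _ _.
Arguments ctsU {R d A B f} _ _ _ _.
Arguments cts_comp {R d d' D D' f r} _ _ _.

(** * Extending maps from the boundary of a box *)

Section Boxes.
Variables (R : realType) (d : nat).
Implicit Types (l u x : 'rV[R]_d).

(** Edges with [l i = u i] are allowed, so the cells of a subdivision are boxes of the same ambient
    space, whatever their dimension. *)
Definition box l u : set 'rV[R]_d :=
  [set x | forall i, l ord0 i <= x ord0 i <= u ord0 i].

Definition bdry l u : set 'rV[R]_d :=
  [set x | box l u x /\ exists i, l ord0 i < u ord0 i /\
     (x ord0 i = l ord0 i \/ x ord0 i = u ord0 i)].

Definition bdim l u : nat := #|[set i | l ord0 i < u ord0 i]%SET|.

Lemma box_compact l u : compact (box l u).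
Proof.
rewrite (_ : box l u =
  [set v : 'rV[R]_d | forall i, `[l ord0 i, u ord0 i]%classic (v ord0 i)]).
  apply: (@rV_compact _ _ (fun i => `[l ord0 i, u ord0 i]%classic)) => i.
  exact: segment_compact.
by apply/seteqP; split=> x /= h i; have := h i; rewrite in_itv.
Qed.

Lemma closed_coord (a : R) i : closed [set x : 'rV[R]_d | x ord0 i = a].
Proof.
rewrite (_ : [set x | _] = (fun x : 'rV[R]_d => x ord0 i) @^-1` [set a]) //.
apply: closed_comp; last exact: closed_eq.
by move=> x _; exact: coord_continuous.
Qed.

Lemma box_closed l u : closed (box l u).
Proof.
apply: compact_closed; last exact: box_compact.
exact: norm_hausdorff.
Qed.

Lemma bdry_closed l u : closed (bdry l u).
Proof.
have -> : bdry l u = box l u `&` \bigcup_(i in [set i | l ord0 i < u ord0 i])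
    ([set x : 'rV[R]_d | x ord0 i = l ord0 i] `|`
     [set x : 'rV[R]_d | x ord0 i = u ord0 i]).
  apply/seteqP; split=> x; first by case=> bx [i [li xi]]; split=> //; exists i.
  by case=> bx [i li xi]; split=> //; exists i.
apply: closedI; first exact: box_closed.
apply: closed_bigcup => [|i _]; first exact: finite_finset.
by apply: closedU; exact: closed_coord.
Qed.

Lemma bdry_box l u : bdry l u `<=` box l u.
Proof. by move=> x []. Qed.

Lemma bdry_compact l u : compact (bdry l u).
Proof.
apply: (subclosed_compact _ (box_compact (l := l) (u := u))).
  exact: bdry_closed.
exact: bdry_box.
Qed.

End Boxes.

(** * Points and maps into flag complexes, in barycentric coordinates *)

Section Points.
Variables (R : realType) (T : choiceType) (e : T -> T -> Prop).
Hypothesis esym : forall u v, e u v -> e v u.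
Hypothesis erefl : forall u, e u u.
Implicit Types (S A : set T).

(* Points of the realization of the flag complex of [e] on [S], except that the
   coordinates need not sum to [1]. *)
Definition pt S (a : T -> R) : Prop :=
  [/\ forall t, 0 <= a t, exists t, a t != 0, forall t, a t != 0 -> S t &
      forall t u, a t != 0 -> a u != 0 -> e t u].

Definition cmap d (D : set 'rV[R]_d) S (f : 'rV[R]_d -> T -> R) : Prop :=
  [/\ forall x, D x -> pt S (f x),
      exists E : seq T, forall x t, D x -> f x t != 0 -> t \in E &
      forall t, cts D (f^~ t)].

Lemma pt_sub S S' a : S `<=` S' -> pt S a -> pt S' a.
Proof. by move=> SS [a0 a1 a2 a3]; split=> // t /a2 /SS. Qed.

Lemma cmap_sub d (D D' : set 'rV[R]_d) S S' f :
  D' `<=` D -> (forall x, D' x -> pt S (f x) -> pt S' (f x)) ->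
  cmap D S f -> cmap D' S' f.
Proof.
move=> DD SS [f1 [E fE] fc]; split.
- by move=> x Dx; apply: SS => //; apply/f1/DD.
- by exists E => x t Dx; apply: fE; exact: DD.
- by move=> t; apply: cts_subset (fc t).
Qed.

Lemma cmap_comp d d' (D : set 'rV[R]_d) (D' : set 'rV[R]_d') S f
    (r : 'rV[R]_d' -> 'rV[R]_d) :
  (forall x, D' x -> D (r x)) -> (forall i, cts D' (fun x => r x ord0 i)) ->
  cmap D S f -> cmap D' S (fun x => f (r x)).
Proof.
move=> rD rc [f1 [E fE] fc]; split.
- by move=> x Dx; apply/f1/rD.
- by exists E => x t Dx; apply: fE; exact: rD.
- by move=> t; apply: (cts_comp (f := f^~ t) rD rc (fc t)).
Qed.

Lemma cmap_glue d (A B : set 'rV[R]_d) S f g :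
  closed A -> closed B -> cmap A S f -> cmap B S g ->
  (forall x, A x -> B x -> f x = g x) ->
  exists h, [/\ cmap (A `|` B) S h, forall x, A x -> h x = f x &
    forall x, B x -> h x = g x].
Proof.
move=> cA cB [f1 [E fE] fc] [g1 [F gF] gc] fg.
pose h x := if `[< A x >] then f x else g x.
have hA x : A x -> h x = f x by rewrite /h; case: asboolP.
have hB x : B x -> h x = g x by rewrite /h; case: asboolP => // Ax Bx; exact: fg.
exists h; split=> //; split.
- move=> x [Ax|Bx]; first by rewrite hA //; apply: f1.
  by rewrite hB //; apply: g1.
- exists (E ++ F) => x t; rewrite mem_cat => -[Ax|Bx].
    by rewrite hA // => /fE ->.
  by rewrite hB // => /gF ->; rewrite // orbT.
- move=> t; apply: ctsU => //.
    by apply: cts_eq (fc t) => x Ax; rewrite hA.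
  by apply: cts_eq (gc t) => x Ax; rewrite hB.
Qed.

(** For two points [f] and [g] of the complex, this says that their supports together span a
    simplex, so that the segment between them stays in the complex. *)
Definition joint (f g : T -> R) := forall t u, f t != 0 -> g u != 0 -> e t u.

Lemma cmap_lin d (D : set 'rV[R]_d) S f g (a b : 'rV[R]_d -> R) :
  (forall x, D x -> joint (f x) (g x)) ->
  (forall x, D x -> [/\ 0 <= a x, 0 <= b x & 0 < a x + b x]) ->
  cts D a -> cts D b -> cmap D S f -> cmap D S g ->
  cmap D S (fun x t => a x * f x t + b x * g x t).
Proof.
move=> fg ab ca cb [f1 [E fE] fc] [g1 [F gF] gc].
have ne x t : a x * f x t + b x * g x t != 0 -> f x t != 0 \/ g x t != 0.
  have [->|] := eqVneq (f x t) 0; last by left.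
  have [->|] := eqVneq (g x t) 0; last by right.
  by rewrite !mulr0 addr0 eqxx.
split.
- move=> x Dx; have [a0 b0 abx] := ab x Dx.
  have [f0 [tf ftf] fS fcl] := f1 x Dx; have [g0 [tg gtg] gS gcl] := g1 x Dx.
  split.
  + by move=> t; rewrite addr_ge0 // mulr_ge0.
  + have [a_eq|a_gt] := eqVneq (a x) 0.
      exists tg; rewrite a_eq mul0r add0r mulf_neq0 //.
      by move: abx; rewrite a_eq add0r; apply: lt0r_neq0.
    exists tf; apply: lt0r_neq0; apply: ltr_wpDr; first exact: mulr_ge0.
    by rewrite mulr_gt0 // lt0r ?a_gt ?ftf ?a0 ?f0.
  + by move=> t /ne[]; [apply: fS|apply: gS].
  + move=> t u /ne[ht|ht] /ne[hu|hu].
    * exact: fcl.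
    * exact: fg ht hu.
    * by apply: esym; apply: fg hu ht.
    * exact: gcl.
- exists (E ++ F) => x t Dx /ne[h|h]; rewrite mem_cat.
    by rewrite (fE x).
  by rewrite (gF x) // orbT.
- by move=> t; apply: cts_add; apply: cts_mul.
Qed.

End Points.

Section RowNorm.
Variables (R : realType) (d : nat).
Implicit Types v : 'rV[R]_d.

Lemma rv_coord_le v i : `|v ord0 i| <= `|v|.
Proof.
have -> : `|v| = mx_norm v by [].
rewrite mx_normrE.
exact: (le_bigmax _ (fun ij : 'I_1 * 'I_d => `|v ij.1 ij.2|) (ord0, i)).
Qed.

Lemma rv_norm_le v k : 0 <= k -> (forall i, `|v ord0 i| <= k) -> `|v| <= k.
Proof.
move=> k0 h; have -> : `|v| = mx_norm v by [].
by rewrite mx_normrE; apply: bigmax_le => // -[i j] _ /=; rewrite (ord1 i).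
Qed.

Lemma rv_norm_at v : 0 < `|v| -> exists i, `|v ord0 i| = `|v|.
Proof.
move=> v0; have : mx_norm v != 0 by exact: lt0r_neq0.
by move/mx_norm_neq0 => [[i j]] /=; rewrite (ord1 i) => h; exists j; exact: esym h.
Qed.

Lemma cts_rv_norm d' (D' : set 'rV[R]_d')
    (z : 'rV[R]_d' -> 'rV[R]_d) :
  (forall i, cts D' (fun x => z x ord0 i)) -> cts D' (fun x => `|z x|).
Proof. by move=> cz x Dx; apply: cvg_norm; apply: cvg_rV => i; exact: cz. Qed.

Lemma closed_cts_ge (f : 'rV[R]_d -> R) : cts setT f -> closed [set x | 0 <= f x].
Proof.
move=> cf; rewrite (_ : [set x | _] = f @^-1` [set y | 0 <= y]) //.
apply: closed_comp; last exact: closed_ge.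
move=> x _ A hA.
have : nbhs x [set y | setT y -> A (f y)] := cf x I A hA.
by apply: filterS => y; apply.
Qed.

End RowNorm.

(** * Filling boxes and straight-line homotopies *)

Section Fill.
Variables (R : realType) (T : choiceType) (e : T -> T -> Prop).
Hypothesis esym : forall u v, e u v -> e v u.
Hypothesis erefl : forall u, e u u.
Implicit Types (S A N : set T) (m : int).

(** Division by the total weight keeps supports, so the result is linearly homotopic to [f]. That it
    changes nothing where the weights already sum to [1] preserves prescribed boundary values. *)
Lemma cmap_normalize d (D : set 'rV[R]_d) S f : cmap e D S f ->
  exists E g, [/\ cmap e D S g, uniq E,
    forall x t, D x -> (g x t != 0) || (f x t != 0) -> t \in E,
    forall x, D x -> \sum_(t <- E) g x t = 1 &
    (forall x, D x -> joint e (f x) (g x)) /\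
    (forall x, D x -> \sum_(t <- E) f x t = 1 -> g x = f x)].
Proof.
move=> cf; have [fp [E0 f0E0] fc] := cf; pose E := undup E0.
have fE x t : D x -> f x t != 0 -> t \in E.
  by move=> Kx ft; rewrite mem_undup; exact: f0E0 ft.
pose s x := \sum_(t <- E) f x t.
have s0 x : D x -> 0 < s x.
  move=> Kx; have [a0 [t ft] _ _] := fp x Kx.
  rewrite /s (bigD1_seq t) ?(fE x) ?undup_uniq //=; apply: ltr_wpDr.
    exact: sumr_ge0.
  by rewrite lt0r ft a0.
(* The zero summand only gives [g] the shape required by [cmap_lin]. *)
pose g x t := (s x)^-1 * f x t + 0 * f x t.
have gf x t : g x t != 0 -> f x t != 0.
  by apply: contra => /eqP h; rewrite /g h !mulr0 addr0.
exists E, g; split; [|exact: undup_uniq|by move=> x t Dx /orP[/gf|]; exact: fE| |].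
- apply: (cmap_lin esym _ _ _ cts_cst cf cf).
  + by move=> x Dx t v; have [_ _ _] := fp x Dx; exact.
  + by move=> x Dx; rewrite addr0 invr_gt0 invr_ge0 ltW ?s0.
  + apply: cts_inv; first by move=> x /s0 h; rewrite gt_eqF.
    by apply: cts_sum => t; exact: fc.
- move=> x Dx; rewrite (eq_bigr (fun t => (s x)^-1 * f x t)).
    by rewrite -mulr_sumr mulVf // gt_eqF ?s0.
  by move=> t _; rewrite /g mul0r addr0.
split=> x Dx; first by move=> t v ft /gf; have [_ _ _] := fp x Dx; exact.
move=> s1; apply/funext => t; rewrite /g (_ : s x = 1) //.
by rewrite invr1 mul1r mul0r addr0.
Qed.

Definition fills d (l u : 'rV[R]_d) S f :=
  exists g, cmap e (box l u) S g /\ forall x, bdry l u x -> g x = f x.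

(* An edge with [l i = u i] contributes neither to [bdry] nor to [bdim]; a point has
   empty boundary, so [pcon (-1) S] says that [S] is nonempty. *)
Definition pcon m S := forall d (l u : 'rV[R]_d),
  (forall i, l ord0 i <= u ord0 i) -> ((bdim l u)%:Z <= m + 1) ->
  forall f, cmap e (bdry l u) S f -> fills l u S f.

Section Collar.
Variables (d : nat) (l u : 'rV[R]_d).
Hypothesis lu : forall i, l ord0 i <= u ord0 i.

Let c i := (l ord0 i + u ord0 i) / 2.
Let r i := (u ord0 i - l ord0 i) / 2.
(* On degenerate edges [z x] is [0], since division by [0] gives [0]. *)
Let z (x : 'rV[R]_d) : 'rV[R]_d := \row_i ((x ord0 i - c i) / r i).
(** Distance from the centre, in the norm whose unit ball is the box. *)
Let rho x := `|z x|.

Let r_ge0 i : 0 <= r i.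
Proof. by rewrite /r; have := lu i; lra. Qed.

Let boxE (x : 'rV[R]_d) : box l u x <-> forall i, `|x ord0 i - c i| <= r i.
Proof.
by split=> h i; have := h i; rewrite /c /r ler_norml => /andP[? ?]; apply/andP; split; lra.
Qed.

Let coord_rho x i : box l u x -> `|x ord0 i - c i| <= rho x * r i.
Proof.
move=> /boxE/(_ i) h; have [r0|r0] := eqVneq (r i) 0; first by rewrite r0 mulr0 -r0.
have ri : 0 < r i by rewrite lt0r r0 r_ge0.
have := rv_coord_le (z x) i; rewrite mxE normrM normfV (gtr0_norm ri).
by rewrite ler_pdivrMr.
Qed.

Let rho_le1 x : box l u x -> rho x <= 1.
Proof.
move=> /boxE h; apply: rv_norm_le => // i; rewrite mxE normrM normfV.
have [r0|r0] := eqVneq (r i) 0; first by rewrite r0 normr0 invr0 mulr0.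
have ri : 0 < r i by rewrite lt0r r0 r_ge0.
by rewrite (gtr0_norm ri) ler_pdivrMr // mul1r.
Qed.

Let rho_bdry x : bdry l u x -> rho x = 1.
Proof.
case=> bx [i [lui xi]]; apply/eqP; rewrite eq_le rho_le1 //=.
have ri : 0 < r i by rewrite /r; lra.
have := rv_coord_le (z x) i; apply: le_trans.
rewrite mxE normrM normfV (gtr0_norm ri) ler_pdivlMr // mul1r.
case: xi => ->; rewrite /c /r ler_normr; first by apply/orP; right; lra.
by apply/orP; left; lra.
Qed.

Let cts_rho D : cts D rho.
Proof.
apply: cts_rv_norm => // i.
apply: (@cts_eq _ _ _ (fun x => (x ord0 i - c i) * (r i)^-1)).
  by move=> x _; rewrite mxE.
by apply: (cts_mul (cts_sub cts_coord cts_cst) cts_cst).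
Qed.

(** Radial projection from the centre onto the boundary. *)
Let p (x : 'rV[R]_d) : 'rV[R]_d := \row_i (c i + (x ord0 i - c i) / rho x).

Let p_bdry x : box l u x -> 1 / 2 <= rho x -> bdry l u (p x).
Proof.
move=> bx rx; have rx0 : 0 < rho x by lra.
split.
  apply/boxE => i; rewrite mxE addrC addKr normrM normfV (gtr0_norm rx0).
  by rewrite ler_pdivrMr // mulrC coord_rho.
have [i hi] := rv_norm_at rx0; exists i.
have ri : 0 < r i.
  rewrite lt0r r_ge0 andbT; apply: contraTneq rx0 => r0.
  by rewrite /rho -hi mxE r0 invr0 mulr0 normr0 ltxx.
have lui : l ord0 i < u ord0 i by move: ri; rewrite /r; lra.
split=> //; rewrite mxE.
have : `|(x ord0 i - c i) / rho x| = r i.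
  rewrite normrM normfV (gtr0_norm rx0).
  have -> : `|x ord0 i - c i| = rho x * r i.
    by rewrite /rho -hi mxE normrM normfV (gtr0_norm ri) divfK // gt_eqF.
  by rewrite mulrAC divff ?mul1r // gt_eqF.
set y := _ / _ => hy; have [y0|y0] := lerP 0 y; [right|left].
  by move: hy; rewrite ger0_norm // => ->; rewrite /c /r; lra.
by move: hy; rewrite ltr0_norm // => hy; rewrite -[y]opprK hy /c /r; lra.
Qed.

(* [f] and [g] are joined by a straight-line homotopy, put on a collar of the box. *)
Lemma fills_joint S f g :
  cmap e (bdry l u) S f -> cmap e (bdry l u) S g ->
  (forall x, bdry l u x -> joint e (f x) (g x)) ->
  fills l u S g -> fills l u S f.
Proof.
move=> cf cg fg [G [cG Gg]].
pose D1 := box l u `&` [set x | 0 <= rho x - 1 / 2].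
pose D2 := box l u `&` [set x | 0 <= 1 / 2 - rho x].
have D1c : closed D1.
  apply: closedI; first exact: box_closed.
  by apply: closed_cts_ge; exact: (cts_sub (@cts_rho _) cts_cst).
have D2c : closed D2.
  apply: closedI; first exact: box_closed.
  by apply: closed_cts_ge; exact: (cts_sub cts_cst (@cts_rho _)).
have pD1 x : D1 x -> bdry l u (p x).
  by move=> [bx /= rx]; apply: p_bdry => //; lra.
have pc i : cts D1 (fun x => p x ord0 i).
  apply: (@cts_eq _ _ _ (fun x => c i + (x ord0 i - c i) * (rho x)^-1)).
    by move=> x _; rewrite mxE.
  apply: (cts_add cts_cst); apply: cts_mul.
    exact: (cts_sub cts_coord cts_cst).
  apply: (cts_inv _ (@cts_rho _)) => x [_ /=] rx; rewrite gt_eqF //; lra.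
(* The inner part [rho <= 1/2] is blown up to the whole box, where [G] is available. *)
pose q (x : 'rV[R]_d) : 'rV[R]_d := \row_i (c i + 2 * (x ord0 i - c i)).
have qD2 x : D2 x -> box l u (q x).
  move=> [bx /= rx]; apply/boxE => i; rewrite mxE addrC addKr normrM ger0_norm //.
  have := coord_rho i bx; have := r_ge0 i; nra.
have qc i : cts D2 (fun x => q x ord0 i).
  apply: (@cts_eq _ _ _ (fun x => c i + 2 * (x ord0 i - c i))).
    by move=> x _; rewrite mxE.
  apply: (cts_add cts_cst); apply: (cts_mul cts_cst).
  exact: (cts_sub cts_coord cts_cst).
(* The weights go from [(0, 1)] at [rho = 1/2], where [g (p x)] matches [G (q x)], to [(1, 0)] on
   the boundary. *)
have c1 : cmap e D1 S (fun x t =>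
    (2 * rho x - 1) * f (p x) t + (2 - 2 * rho x) * g (p x) t).
  apply: (cmap_lin esym _ _ _ _ (cmap_comp pD1 pc cf) (cmap_comp pD1 pc cg)).
  - by move=> x /pD1; exact: fg.
  - by move=> x [bx /= rx]; have := rho_le1 bx; split; lra.
  - by apply: (cts_sub _ cts_cst); exact: (cts_mul cts_cst (@cts_rho _)).
  - exact: (cts_sub cts_cst (cts_mul cts_cst (@cts_rho _))).
have c2 := cmap_comp qD2 qc cG.
have [|h [ch h1 h2]] := cmap_glue D1c D2c c1 c2.
  move=> x D1x [_ /= rx]; have [bx /= rx'] := D1x.
  have r12 : rho x = 1 / 2 by lra.
  apply/funext => t; rewrite r12 (_ : q x = p x).
    by rewrite (Gg _ (pD1 _ D1x)); lra.
  by apply/rowP => i; rewrite !mxE r12; congr (_ + _); field.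
exists h; split.
  apply: (@cmap_sub _ _ _ _ _ _ _ S) ch => // x bx.
  by have [rx|rx] := lerP (rho x) (1 / 2); [right|left]; split=> //=; lra.
move=> x bx; have r1 := rho_bdry bx.
rewrite h1; last by split; [exact: bdry_box|rewrite /= r1; lra].
have -> : p x = x by apply/rowP => i; rewrite mxE r1; lra.
by apply/funext => t; rewrite r1; lra.
Qed.
End Collar.

(** Every map is joint with the constant map to the apex, and a constant map extends. *)
Lemma pcon_cone m S v : S v -> (forall u, S u -> e v u) -> pcon m S.
Proof.
move=> Sv hv d l u lu _ f cf.
pose g (x : 'rV[R]_d) (t : T) : R := (t == v)%:R.
have gv x t : g x t != 0 -> t = v.
  by rewrite /g; have [//|/negbTE tv] := eqVneq t v; rewrite ?tv eqxx.
have cg D : cmap e D S g.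
  split.
  - move=> x _; split=> [t||t /gv->|t w /gv-> /gv->] //.
    by exists v; rewrite /g eqxx oner_eq0.
  - by exists [:: v] => x t _ /gv->; rewrite inE.
  - by move=> t; exact: cts_cst.
apply: (fills_joint lu cf (cg _)); last by exists g; split.
move=> x bx t w ft /gv->.
by apply/esym/hv; case: cf => /(_ x bx) [_ _ + _] _ _; apply.
Qed.

End Fill.

(** * Attaching vertices *)

(** Together with the next lemma, this compares grid intervals: index [k] will stand for the span
    from [k./2] to [uphalf k]. *)
Lemma half_lt_uphalf a b : (a./2 < uphalf b)%N -> (a./2 <= b./2)%N.
Proof. by rewrite uphalf_half; case: (odd b) => //; exact: ltnW. Qed.

Lemma uphalf_le_uphalf a b : (a./2 < uphalf b)%N -> (uphalf a <= uphalf b)%N.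
Proof. by apply: leq_trans; rewrite uphalf_half; case: (odd a). Qed.

(** * Subdivision of a box into cells *)

Section Grid.
Variables (R : realType) (d : nat) (l u : 'rV[R]_d) (n : nat).
Hypothesis lu : forall i, l ord0 i <= u ord0 i.
Hypothesis n0 : (0 < n)%N.

Definition gridpt i (k : nat) : R :=
  l ord0 i + (u ord0 i - l ord0 i) * (k%:R / n%:R).

(* The even index [2k] stands for the point [k] of the subdivided edge, the odd
   index [2k+1] for the interval [k, k+1]. *)
Definition cell_index := {ffun 'I_d -> 'I_(n.*2.+1)}.
Implicit Types q : cell_index.

Definition cell_lo q : 'rV[R]_d := \row_i gridpt i (q i)./2.
Definition cell_hi q : 'rV[R]_d := \row_i gridpt i (uphalf (q i)).
Definition cell q := box (cell_lo q) (cell_hi q).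
Definition cell_dim q := bdim (cell_lo q) (cell_hi q).
Definition bcell q := [exists i, (l ord0 i < u ord0 i) &&
  ((q i == 0 :> nat) || (q i == n.*2 :> nat))].

Let nR : 0 < n%:R :> R. Proof. by rewrite ltr0n. Qed.

Lemma gridpt_le i k k' : (k <= k')%N -> gridpt i k <= gridpt i k'.
Proof.
move=> kk; rewrite lerD2l; apply: ler_wpM2l; first by rewrite subr_ge0.
by rewrite ler_pM2r ?invr_gt0 // ler_nat.
Qed.

Lemma gridpt_lt i k k' : l ord0 i < u ord0 i ->
  (gridpt i k < gridpt i k') = (k < k')%N.
Proof.
move=> li; rewrite ltrD2l ltr_pM2l ?subr_gt0 //.
by rewrite ltr_pM2r ?invr_gt0 // ltr_nat.
Qed.

Lemma gridpt_ltW i k k' : gridpt i k < gridpt i k' -> l ord0 i < u ord0 i.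
Proof.
move=> h; rewrite lt_neqAle lu andbT; apply: contraTneq h => h.
by rewrite /gridpt h subrr !mul0r ltxx.
Qed.

Lemma gridpt0 i : gridpt i 0 = l ord0 i.
Proof. by rewrite /gridpt mul0r mulr0 addr0. Qed.

Lemma gridptn i : gridpt i n = u ord0 i.
Proof. by rewrite /gridpt divff ?gt_eqF // mulr1 addrC subrK. Qed.

Lemma cell_le q i : cell_lo q ord0 i <= cell_hi q ord0 i.
Proof. by rewrite !mxE; apply: gridpt_le; lia. Qed.

Lemma cell_bdry q : bcell q -> cell q `<=` bdry l u.
Proof.
move=> /existsP[i /andP[li qi]] x cx; split.
  move=> j; have /andP[h1 h2] := cx j; rewrite !mxE in h1 h2; apply/andP; split.
    by apply: le_trans h1; rewrite -gridpt0; exact: gridpt_le.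
  apply: (le_trans h2); rewrite -gridptn; apply: gridpt_le.
  by have := ltn_ord (q j); lia.
exists i; split=> //.
have /andP[h1 h2] := cx i; rewrite !mxE in h1 h2.
move: qi => /orP[/eqP qi|/eqP qi]; rewrite qi in h1 h2; [left|right];
  apply/eqP; rewrite eq_le.
  by move: h1 h2; rewrite gridpt0 => -> ->.
by move: h1 h2; rewrite doubleK uphalf_double gridptn => -> ->.
Qed.

Lemma bdry_cell x : bdry l u x -> exists2 q, bcell q & cell q x.
Proof.
case=> bx [i0 [li0 xi0]].
pose s i := (x ord0 i - l ord0 i) / (u ord0 i - l ord0 i) * n%:R.
(* The extreme indices are forced at the end points, so that the chosen cell is a boundary cell. On
   a degenerate edge both ends coincide and index [0] is taken, whence the restriction in the last
   clause. *)
have /choice[f hf] : forall i, exists k : 'I_(n.*2.+1),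
    [/\ gridpt i k./2 <= x ord0 i <= gridpt i (uphalf k),
      x ord0 i = l ord0 i -> k = 0 :> nat &
      x ord0 i = u ord0 i -> l ord0 i < u ord0 i -> k = n.*2 :> nat].
  move=> i.
  have /andP[lx xu] := bx i.
  have [xl|xl] := eqVneq (x ord0 i) (l ord0 i).
    exists ord0; split=> //=; first by rewrite gridpt0 xl lexx.
    by move=> xu'; rewrite -xu' xl ltxx.
  have [xu'|xu'] := eqVneq (x ord0 i) (u ord0 i).
    exists ord_max; split=> //=; last by move=> xl'; rewrite xl' eqxx in xl.
    by rewrite doubleK uphalf_double gridptn xu' lexx.
  have lx' : l ord0 i < x ord0 i by rewrite lt_neqAle eq_sym xl.
  have xu1 : x ord0 i < u ord0 i by rewrite lt_neqAle xu' xu.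
  have ul : 0 < u ord0 i - l ord0 i by lra.
  have s0 : 0 <= s i.
    by rewrite mulr_ge0 ?(ltW nR) // divr_ge0 // ?subr_ge0 // ltW.
  have sn : s i < n%:R.
    by rewrite -[ltRHS]mul1r ltr_pM2r // ltr_pdivrMr // mul1r; lra.
  have := truncn_itv s0; set k := Num.truncn _ => /andP[ks sk].
  have kn : (k < n)%N by rewrite -(ltr_nat R); exact: le_lt_trans ks sn.
  have kn' : (k.*2.+1 < n.*2.+1)%N by rewrite ltnS ltn_double.
  have xE : x ord0 i = l ord0 i + (u ord0 i - l ord0 i) * (s i / n%:R).
    by rewrite /s mulfK ?gt_eqF // mulrC divfK ?gt_eqF //; lra.
  exists (Ordinal kn'); split=> /=.
  - rewrite uphalf_double doubleK /gridpt xE !lerD2l !ler_pM2l //.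
    by rewrite !ler_pM2r ?invr_gt0 // ks ltW.
  - by move=> h; rewrite h eqxx in xl.
  - by move=> h; rewrite h eqxx in xu'.
exists [ffun i => f i].
  apply/existsP; exists i0; rewrite li0 /= !ffunE.
  have [_ h1 h2] := hf i0.
  by case: xi0 => h; [rewrite (h1 h) eqxx|rewrite (h2 h li0) eqxx orbT].
by move=> i; rewrite !mxE !ffunE; have [] := hf i.
Qed.

(** In each direction where [q] is nondegenerate, [x] lies strictly between its two grid points;
    strict inequalities of grid points are strict inequalities of integers, so the span of [q']
    covers that of [q]. *)
Lemma cell_minimal q q' x : cell q x -> ~ bdry (cell_lo q) (cell_hi q) x ->
  cell q' x -> cell q `<=` cell q'.
Proof.
move=> cx nb cx' y cy i.
have /andP[h1 h2] := cx i; have /andP[h1' h2'] := cx' i; have /andP[k1 k2] := cy i.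
have [hlt|] := boolP (cell_lo q ord0 i < cell_hi q ord0 i); last first.
  rewrite -leNgt => hge; have : x ord0 i = y ord0 i by lra.
  by move=> <-; rewrite h1' h2'.
have lx : cell_lo q ord0 i < x ord0 i.
  rewrite lt_neqAle h1 andbT; apply/negP => /eqP hx; apply: nb; split=> //.
  by exists i; split=> //; left.
have xu : x ord0 i < cell_hi q ord0 i.
  rewrite lt_neqAle h2 andbT; apply/negP => /eqP hx; apply: nb; split=> //.
  by exists i; split=> //; right.
rewrite !mxE in hlt lx xu h1' h2' k1 k2 *.
have li := gridpt_ltW hlt.
have := le_lt_trans h1' xu; rewrite gridpt_lt // => a1.
have := lt_le_trans lx h2'; rewrite gridpt_lt // => a2.
apply/andP; split.
  by apply: le_trans k1; apply: gridpt_le; exact: half_lt_uphalf.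
by apply: (le_trans k2); apply: gridpt_le; exact: uphalf_le_uphalf.
Qed.

Lemma cell_face q x : bdry (cell_lo q) (cell_hi q) x ->
  exists q', [/\ bcell q -> bcell q', cell q' x & (cell_dim q' < cell_dim q)%N].
Proof.
case=> cx [i [hlt xi]]; have := hlt; rewrite !mxE => hlt'.
have li := gridpt_ltW hlt'; have := hlt'; rewrite gridpt_lt // => qo.
(* The index [q i] is odd, and [k] is the even neighbour on the side of [x]. Oddness also shows that
   direction [i] is not what makes [q] a boundary cell, so changing it keeps [bcell]. *)
have [k [k1 k2 k3]] : exists k : 'I_(n.*2.+1), [/\ k./2 = uphalf k,
    gridpt i k./2 = x ord0 i & (q i : nat) \notin [:: 0; n.*2]%N].
  case: xi; rewrite mxE => xi.
    have kn : ((q i).-1 < n.*2.+1)%N by have := ltn_ord (q i); lia.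
    exists (Ordinal kn); rewrite !inE /=; split; [lia| |lia].
    by rewrite xi; congr gridpt; lia.
  have kn : ((q i).+1 < n.*2.+1)%N by have := ltn_ord (q i); lia.
  exists (Ordinal kn); rewrite !inE /=; split; [lia| |lia].
  by rewrite xi; congr gridpt; lia.
pose q' : cell_index := [ffun j => if j == i then k else q j].
have qi' : q' i = k by rewrite ffunE eqxx.
have qj' j : j != i -> q' j = q j by rewrite ffunE => /negbTE->.
exists q'; split.
- move=> /existsP[j /andP[lj qj]]; apply/existsP; exists j; rewrite lj /=.
  rewrite qj' //; apply: contraNneq k3 => <-.
  by rewrite !inE.
- move=> j; rewrite !mxE; have [->|ji] := eqVneq j i.
    by rewrite qi' -k1 k2 lexx.
  by rewrite qj' //; have := cx j; rewrite !mxE.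
- apply: proper_card; apply/properP; split.
    apply/fintype.subsetP => j; rewrite !inE !mxE; have [->|ji] := eqVneq j i.
      by rewrite qi' -k1 ltxx.
    by rewrite qj'.
  by exists i; rewrite !inE !mxE // qi' -k1 ltxx.
Qed.

Lemma bcell_dim q : bcell q -> (cell_dim q < bdim l u)%N.
Proof.
move=> /existsP[i /andP[li qi]]; apply: proper_card; apply/properP; split.
  by apply/fintype.subsetP => j; rewrite !inE !mxE; exact: gridpt_ltW.
exists i; rewrite !inE // !mxE.
have -> : (q i)./2 = uphalf (q i) by case/orP: qi => /eqP->; lia.
by rewrite ltxx.
Qed.

Lemma cell_diam q x y i : cell q x -> cell q y ->
  `|x ord0 i - y ord0 i| <= (u ord0 i - l ord0 i) / n%:R.
Proof.
move=> cx cy; have /andP[h1 h2] := cx i; have /andP[k1 k2] := cy i.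
rewrite !mxE in h1 h2 k1 k2.
have : gridpt i (uphalf (q i)) <= gridpt i (q i)./2.+1 by apply: gridpt_le; lia.
have -> : gridpt i (q i)./2.+1 = gridpt i (q i)./2 + (u ord0 i - l ord0 i) / n%:R.
  by rewrite /gridpt -(natr1 (q i)./2); ring.
by move=> h; rewrite ler_norml; apply/andP; split; lra.
Qed.

End Grid.

(** * Pushing a map off the attached vertices *)

Section Attach.
Variables (R : realType) (T : choiceType) (e : T -> T -> Prop).
Hypothesis esym : forall u v, e u v -> e v u.
Hypothesis erefl : forall u, e u u.
Variables (A N : set T) (m : int).
Hypothesis disj : forall v, N v -> ~ A v.
Hypothesis indep : forall u v, N u -> N v -> e u v -> u = v.
Hypothesis linkN : forall v, N v -> pcon R e (m - 1) [set u | A u /\ e v u].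

Section Push.
Variables (d : nat) (l u : 'rV[R]_d) (f : 'rV[R]_d -> T -> R) (E : seq T).
Hypothesis lu : forall i, l ord0 i <= u ord0 i.
Hypothesis dimlu : (bdim l u)%:Z <= m + 1.
Hypothesis cf : cmap e (bdry l u) (A `|` N) f.
Hypothesis fE : forall x t, bdry l u x -> f x t != 0 -> t \in E.
Hypothesis uE : uniq E.
Hypothesis f1 : forall x, bdry l u x -> \sum_(t <- E) f x t = 1.

Definition nweight x := \sum_(t <- E | `[< N t >]) f x t.
Local Notation w := nweight.

Lemma cts_nweight : cts (bdry l u) w.
Proof. by apply: cts_sum => t; case: cf => _ _; exact. Qed.

(** By independence of [N], the simplex carrying [f x] has at most one new vertex. *)
Lemma nweightE x v : bdry l u x -> N v -> f x v != 0 -> w x = f x v.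
Proof.
move=> Kx Nv fv; rewrite /nweight big_mkcond (bigD1_seq v) ?(fE Kx) //=; case: asboolP => // _.
rewrite big1_seq ?addr0 // => t /andP[tv tE]; case: asboolP => // Nt.
apply/eqP; apply: contraNT tv => ft; apply/eqP/indep => //.
by case: cf => /(_ x Kx) [_ _ _ + ] _ _; exact.
Qed.

Lemma nweight_vertex x : bdry l u x -> w x != 0 -> exists2 v, N v & f x v != 0.
Proof.
move=> Kx; apply: contra_neqP => h; rewrite /nweight big1 // => t /asboolP Nt.
by apply/eqP; apply: contrapT => /negP ft; apply: h; exists t.
Qed.

Lemma nweight_lt1 x : bdry l u x -> w x != 1 -> exists t, A t /\ f x t != 0.
Proof.
move=> Kx; apply: contra_neqP => h; rewrite -(f1 Kx) [RHS](bigID (fun t => `[< N t >])) /=.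
rewrite [X in _ + X]big1 ?addr0 // => t /asboolP Nt.
apply/eqP; apply: contrapT => /negP ft; apply: h; exists t; split=> //.
by case: cf => /(_ x Kx) [_ _ /(_ t ft) []].
Qed.

(* Once the old coordinates of [f x] are faded out where the new ones dominate, the
   straight line from [f x] to a point [a] with [pushed x a] stays in a simplex. *)
Definition pushed x (a : T -> R) :=
  (forall v t, N v -> f x v != 0 -> a t != 0 -> e v t) /\
  (w x < 1 / 2 -> forall t, a t != 0 -> f x t != 0).

Section Cells.
Variable n : nat.
Hypothesis n0 : (0 < n)%N.
Local Notation bcell := (@bcell R d l u n).
Local Notation cell := (@cell R d l u n).
Local Notation cell_lo := (@cell_lo R d l u n).
Local Notation cell_hi := (@cell_hi R d l u n).
Local Notation cell_dim := (@cell_dim R d l u n).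
(** Small enough for two purposes: on a cell with a point where [w < 1/2], the weight [w] never
    reaches [1], so dropping the new coordinate leaves a nonzero point; and a new vertex of weight
    at least [1/2] at one corner keeps positive weight on the whole cell. *)
Hypothesis small : forall q x y t, bcell q -> cell q x -> cell q y -> t \in E ->
  `|f x t - f y t| < 1 / 4.

(** The third clause makes [Y] a union of boundary cells, so by [cell_minimal] a cell not contained
    in [Y] meets [Y] only in its boundary. *)
Definition pushed_on Y g :=
  [/\ closed Y, Y `<=` bdry l u,
      forall x, Y x -> exists q, [/\ bcell q, cell q x & cell q `<=` Y],
      cmap e Y A g & forall x, Y x -> pushed x (g x)].

(** A single new vertex [v] has positive weight on all of the cell, so by [pushed] the boundary of
    the cell is already mapped into the link of [v]. A boundary cell has dimension at most [m],
    which is what an [(m-1)]-connected link can fill. *)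
Lemma pushed_on_cell Y g q : pushed_on Y g -> bcell q ->
  (forall x, cell q x -> 1 / 2 <= w x) -> bdry (cell_lo q) (cell_hi q) `<=` Y ->
  exists g', pushed_on (Y `|` cell q) g'.
Proof.
move=> [cY YK Ycell cg gp] bq deep bY.
have [qY|qY] := pselect (cell q `<=` Y).
  by exists g; rewrite (setUidl qY).
have qK : cell q `<=` bdry l u by exact: cell_bdry.
have Yq x : Y x -> cell q x -> bdry (cell_lo q) (cell_hi q) x.
  move=> Yx qx; apply: contrapT => nb; apply: qY.
  have [q' [bq' q'x q'Y]] := Ycell x Yx.
  exact: (subset_trans (cell_minimal lu n0 qx nb q'x)).
have x0q : cell q (cell_lo q) by move=> i; rewrite lexx cell_le.
have [v Nv fv] : exists2 v, N v & f (cell_lo q) v != 0.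
  apply: nweight_vertex; first exact: qK.
  by have := deep _ x0q; move=> h; rewrite gt_eqF //; lra.
have fv0 : 1 / 2 <= f (cell_lo q) v.
  by rewrite -(nweightE (qK _ x0q) Nv fv); exact: deep.
have fvq y : cell q y -> f y v != 0.
  move=> qy; have := small bq x0q qy (fE (qK _ x0q) fv).
  by rewrite ltr_norml => /andP[h1 h2]; rewrite gt_eqF //; lra.
have cgb : cmap e (bdry (cell_lo q) (cell_hi q)) [set u | A u /\ e v u] g.
  apply: cmap_sub cg => // x bx [a0 a1 a2 a3]; split=> // t at0; split; first exact: a2.
  have [h _] := gp x (bY x bx); apply: h at0 => //.
  by apply: fvq; exact: bdry_box bx.
have [h [ch hg]] : fills e (cell_lo q) (cell_hi q) [set u | A u /\ e v u] g.
  apply: (linkN Nv) => //; first by move=> i; exact: cell_le.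
  have := bcell_dim lu n0 bq; rewrite /cell_dim; move: dimlu; lia.
have ch' : cmap e (cell q) A h.
  by apply: cmap_sub ch => // x _; apply: pt_sub => t [].
have [|g' [cg' g'Y g'q]] := cmap_glue cY (@box_closed _ _ _ _) cg ch'.
  by move=> x Yx qx; rewrite hg //; exact: Yq.
exists g'; split=> //.
- by apply: closedU => //; exact: box_closed.
- by move=> x [/YK|/qK].
- move=> x [/Ycell[q' [bq' q'x q'Y]]|qx].
    by exists q'; split=> // y /q'Y; left.
  by exists q; split=> // y qy; right.
- move=> x [Yx|qx]; first by rewrite g'Y //; exact: gp.
  rewrite g'q //; split; last by have := deep x qx; move=> h1 h2; lra.
  move=> v' t Nv' fv' ht; have -> : v' = v.
    apply: indep => //; case: cf => /(_ x (qK x qx)) [_ _ _ + ] _ _; apply=> //.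
    exact: fvq.
  by case: ch => /(_ x qx) [_ _ + _] _ _ => /(_ t ht) [].
Qed.

Lemma push_cells : exists g, cmap e (bdry l u) A g /\
  forall x, bdry l u x -> pushed x (g x).
Proof.
(* On the cells of [O] the new coordinates can be dropped; the remaining cells are
   filled inside the link of a single new vertex, in order of dimension. *)
pose O := [set q | bcell q /\ exists x, cell q x /\ w x < 1 / 2].
pose Y0 := \bigcup_(q in O) cell q.
pose g0 x t := if `[< N t >] then 0 else f x t.
have g0f x t : g0 x t != 0 -> f x t != 0.
  by rewrite /g0; case: asboolP; rewrite ?eqxx.
have Y0K : Y0 `<=` bdry l u by move=> x [q [bq _]]; exact: cell_bdry.
have Y0w x : Y0 x -> w x != 1.
  move=> [q [bq [y [qy wy]]] qx]; apply/eqP => w1.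
  have Kx := cell_bdry lu n0 bq qx; have Ky := cell_bdry lu n0 bq qy.
  have [v Nv fv] : exists2 v, N v & f x v != 0.
    by apply: nweight_vertex => //; rewrite w1 oner_eq0.
  have := nweightE Kx Nv fv; rewrite w1 => fv1.
  have := small bq qx qy (fE Kx fv); rewrite -fv1 ltr_norml => /andP[h1 h2].
  have fyv : f y v != 0 by rewrite gt_eqF //; lra.
  by have := nweightE Ky Nv fyv => h; lra.
have st0 : pushed_on Y0 g0.
  split=> //.
  - apply: closed_bigcup; first exact: (@finite_finset {ffun 'I_d -> 'I_(n.*2.+1)}).
    by move=> q _; exact: box_closed.
  - by move=> x [q Oq qx]; exists q; split=> //; [case: Oq|move=> y qy; exists q].
  - split.
    + move=> x Y0x; have Kx := Y0K x Y0x; case: cf => /(_ x Kx) [a0 _ aS acl] _ _.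
      split.
      * by move=> t; rewrite /g0; case: ifP.
      * have [t [At ft]] := nweight_lt1 Kx (Y0w x Y0x).
        by exists t; rewrite /g0; case: asboolP => // /disj.
      * move=> t; rewrite /g0; case: asboolP; first by rewrite eqxx.
        by move=> Nt /aS [].
      * by move=> t v /g0f ht /g0f hv; exact: acl.
    + by exists E => x t /Y0K Kx /g0f; exact: fE.
    + move=> t; rewrite /g0; case: asboolP => _; first exact: cts_cst.
      by apply: cts_subset Y0K _; case: cf => _ _; exact.
  - move=> x /Y0K Kx; split; last by move=> _ t /g0f.
    by move=> v t Nv fv /g0f ft; case: cf => /(_ x Kx) [_ _ _ + ] _ _; exact.
have claim j : exists Y g, [/\ pushed_on Y g, Y0 `<=` Y &
    forall q, bcell q -> (cell_dim q < j)%N -> cell q `<=` Y].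
  elim: j => [|j [Y [g [st YY low]]]]; first by exists Y0, g0; split.
  (* The cells of dimension [j] are added one at a time along a list of all indices; cells of
     smaller dimension already cover their boundaries. *)
  suff inner (s : seq (cell_index d n)) : exists Y g, [/\ pushed_on Y g, Y0 `<=` Y,
      forall q, bcell q -> (cell_dim q < j)%N -> cell q `<=` Y &
      forall q, q \in s -> bcell q -> (cell_dim q <= j)%N -> cell q `<=` Y].
    have [Y' [g' [st' YY' low' all']]] := inner (enum (cell_index d n)).
    by exists Y', g'; split=> // q bq hq; apply: all' => //; rewrite mem_enum.
  elim: s => [|q s [Y1 [g1 [st1 YY1 low1 all1]]]]; first by exists Y, g; split.
  have [qY1|qY1] := pselect (cell q `<=` Y1).
    exists Y1, g1; split=> // q'; rewrite inE => /orP[/eqP->//|]; exact: all1.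
  have [bq|bq] := boolP (bcell q); last first.
    by exists Y1, g1; split=> // q'; rewrite inE => /orP[/eqP->|]; [rewrite (negbTE bq)|exact: all1].
  have [hq|hq] := leqP (cell_dim q) j; last first.
    exists Y1, g1; split=> // q'; rewrite inE => /orP[/eqP->|]; last exact: all1.
    by move=> _; rewrite leqNgt hq.
  have deep x : cell q x -> 1 / 2 <= w x.
    move=> qx; rewrite leNgt; apply/negP => wx; apply: qY1 => y qy; apply: YY1.
    by exists q => //; split=> //; exists x.
  have [g2 st2] : exists g', pushed_on (Y1 `|` cell q) g'.
    apply: (pushed_on_cell st1) => // x bx.
    have [q' [/(_ bq) bq' q'x q'q]] := cell_face lu n0 bx.
    by apply: (low1 q') => //; exact: leq_trans hq.
  exists (Y1 `|` cell q), g2; split=> //.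
  - by move=> x /YY1; left.
  - by move=> q' bq' hq' x /(low1 _ bq' hq'); left.
  - move=> q'; rewrite inE => /orP[/eqP-> _ _ x qx|q's bq' hq' x q'x]; first by right.
    by left; apply: (all1 q').
have [Y [g [[cY YK _ cg gp] _ all]]] := claim d.+1.
have KY : bdry l u `<=` Y.
  move=> x /(bdry_cell lu n0)[q bq qx]; apply: (all q) => //.
  by rewrite ltnS -[leqRHS]card_ord max_card.
exists g; split; last by move=> x /KY; exact: gp.
by apply: cmap_sub cg.
Qed.
End Cells.

Lemma push : exists g, cmap e (bdry l u) A g /\
  forall x, bdry l u x -> pushed x (g x).
Proof.
have [||del d0 unif] := @cts_unif R d (bdry l u) T E f (1 / 4) (@bdry_compact _ _ _ _).
- by case: cf => _ _; exact.
- by lra.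
(* The sum of the edge lengths bounds each of them, so one [n] suits all directions. *)
pose s := \sum_i (u ord0 i - l ord0 i).
have s0 : 0 <= s by apply: sumr_ge0 => i _; rewrite subr_ge0.
have [n hn] : exists n : nat, s / del < n%:R.
  by exists (Num.truncn (s / del)).+1; have /andP[] := truncn_itv (divr_ge0 s0 (ltW d0)).
have n0 : (0 < n)%N.
  by rewrite -(ltr_nat R); apply: le_lt_trans hn; exact: divr_ge0 s0 (ltW d0).
apply: (push_cells n0) => q x y t bq qx qy tE.
have qK := cell_bdry lu n0 bq.
apply: unif => //; [exact: qK|exact: qK|move=> i].
apply: le_lt_trans (cell_diam lu n0 i qx qy) _.
rewrite ltr_pdivrMr ?ltr0n //; rewrite ltr_pdivrMr // mulrC in hn.
apply: le_lt_trans hn; rewrite /s (bigD1 i) //= lerDl.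
by apply: sumr_ge0 => j _; rewrite subr_ge0.
Qed.

End Push.

(** Straight-line homotopies lead from [f0] to its normalization [f], then to the faded map [f2],
    then to the pushed map [g], which takes values over [A] and is filled there by hypothesis. *)
Lemma pcon_attach : pcon R e m A -> pcon R e m (A `|` N).
Proof.
move=> cA d l u lu dimlu f0 cf0.
have [E [f [cf uE fE0 f1 [jf _]]]] := cmap_normalize esym cf0.
have fE x t : bdry l u x -> f x t != 0 -> t \in E.
  by move=> Kx ft; apply: (fE0 x) => //; rewrite ft.
have [g [cg gp]] := push lu dimlu cf fE uE f1.
pose w := nweight f E.
(* The factor on the old coordinates is continuous, equals [1] where [w = 0], and vanishes once
   [w >= 1/2], the range where [pushed] does not compare [g] with the old coordinates. *)
pose f2 x t := (if `[< N t >] then 1 else Num.max 0 (1 - 2 * w x)) * f x t.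
have f2f x t : f2 x t != 0 -> f x t != 0.
  by rewrite /f2 mulf_eq0 => /norP[].
have cf2 : cmap e (bdry l u) (A `|` N) f2.
  have [fp _ fc] := cf; split.
  - move=> x Kx; have [a0 [t0 ft0] aS acl] := fp x Kx; split.
    + move=> t; rewrite /f2 mulr_ge0 //; case: ifP => // _.
      by rewrite le_max lexx.
    + have [w0|w0] := eqVneq (w x) 0.
        exists t0; rewrite /f2; case: ifP => _; rewrite ?mul1r // w0 mulr0 subr0.
        by rewrite max_r // mul1r.
      have [v Nv fv] := nweight_vertex Kx w0.
      by exists v; rewrite /f2; case: asboolP => // _; rewrite mul1r.
    + by move=> t /f2f; exact: aS.
    + by move=> t v /f2f ht /f2f; exact: acl.
  - by exists E => x t Kx /f2f; exact: fE.
  - move=> t; apply: cts_mul (fc t); case: asboolP => _; first exact: cts_cst.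
    apply: cts_max cts_cst _; apply: cts_sub cts_cst _; apply: cts_mul cts_cst _.
    exact: (cts_nweight cf).
have cgS : cmap e (bdry l u) (A `|` N) g.
  by apply: cmap_sub cg => // x _; apply: pt_sub => t; left.
have [G [cG Gg]] := cA d l u lu dimlu g cg.
have fillg : fills e l u (A `|` N) g.
  exists G; split=> //; apply: cmap_sub cG => // x _; apply: pt_sub => t; left=> //.
apply: (fills_joint esym lu cf0 cf jf).
apply: (fills_joint esym lu cf cf2).
  move=> x Kx t v ft /f2f fv; have [fp _ _] := cf.
  by have [_ _ _] := fp x Kx; exact.
apply: (fills_joint esym lu cf2 cgS) fillg => x Kx t v ft gv.
have [g1 g2] := gp x Kx; move: (ft) (f2f _ _ ft) => + ft'.
rewrite /f2; case: asboolP => Nt; first by move=> _; exact: (g1 t v Nt ft' gv).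
move=> hw; have wx : w x < 1 / 2.
  rewrite ltNge; apply: contra hw => hw; rewrite max_l ?mul0r //; lra.
have fv := g2 wx v gv; have [fp _ _] := cf.
by have [_ _ _] := fp x Kx; exact.
Qed.

End Attach.

(** * From certificates to connectedness of the realization *)

Section Soundness.
Variables (R : realType) (T : choiceType) (e : T -> T -> Prop).
Hypothesis esym : forall u v, e u v -> e v u.
Hypothesis erefl : forall u, e u u.
Implicit Types (S : set T) (m : int).

Lemma conn_pcon m S : conn e m S -> pcon R e m S.
Proof.
elim=> {m S}.
- by move=> m S hm d l u _ hd; lia.
- by move=> m S v Sv hv; exact: pcon_cone Sv hv.
- move=> m A N S _ IH -> disj indep _ IHl; exact: pcon_attach disj indep IHl IH.
Qed.

Lemma pcon_nonempty m S : pcon R e m S -> -1 <= m ->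
  exists a : T -> R, pt e S a /\ exists E : seq T, forall t, a t != 0 -> t \in E.
Proof.
move=> cS hm; have [|||g [cg _]] := cS 0 (0 : 'rV[R]_0) (0 : 'rV[R]_0) _ _ (fun _ _ => 0).
- by case.
- rewrite (_ : bdim _ _ = 0%N); [lia|by apply: eq_card0 => -[]].
- split; [by move=> x [_ [[]]]|by exists [::] => x t [_ [[]]]|].
  by move=> t; exact: cts_cst.
have b0 : box (0 : 'rV[R]_0) 0 0 by case.
case: cg => /(_ 0 b0) h1 [E hE] _; exists (g 0); split=> //.
by exists E => t; exact: hE.
Qed.

Section Sphere.
Variables (k : nat) (m : int) (S : set T).
Local Notation V := 'rV[R]_k.+1.
Let sq (x : V) := \sum_i x ord0 i ^+ 2.
Let n2 (x : V) := Num.sqrt (sq x).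
Let sphere : set V := [set x | sq x = 1].
Let disk : set V := [set x | sq x <= 1].

Let cts_sq D : cts D sq.
Proof. by apply: cts_sum => i; apply: cts_mul; exact: cts_coord. Qed.

Let cts_n2 D : cts D n2.
Proof.
move=> x Dx; apply: continuous_cvg; first exact: sqrt_continuous.
exact: cts_sq.
Qed.

Let sq_ge (x : V) i : x ord0 i ^+ 2 <= sq x.
Proof. by rewrite /sq (bigD1 i) //= lerDl sumr_ge0 // => j _; exact: sqr_ge0. Qed.

Let proj (x : V) : V := (n2 x)^-1 *: x.

Let proj_sphere x : sq x != 0 -> sphere (proj x).
Proof.
move=> x0; rewrite /sphere /= /proj.
have sx : 0 < sq x by rewrite lt0r x0 sumr_ge0 // => i _; exact: sqr_ge0.
rewrite {1}/sq (eq_bigr (fun i => (sq x)^-1 * x ord0 i ^+ 2)).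
  by rewrite -mulr_sumr mulVf.
by move=> i _; rewrite mxE exprMn exprVn sqr_sqrtr // ltW.
Qed.

Let proj_scale c x : 0 < c -> proj (c *: x) = proj x.
Proof.
move=> c0; rewrite /proj /n2.
have -> : sq (c *: x) = c ^+ 2 * sq x.
  by rewrite /sq mulr_sumr; apply: eq_bigr => i _; rewrite mxE exprMn.
rewrite sqrtrM ?sqr_ge0 // sqrtr_sqr gtr0_norm // scalerA invfM.
by rewrite mulrAC mulVf ?mul1r // gt_eqF.
Qed.

Let proj_id x : sphere x -> proj x = x.
Proof. by move=> sx; rewrite /proj /n2 sx sqrtr1 invr1 scale1r. Qed.

Let cts_proj D i : (forall x, D x -> sq x != 0) -> cts D (fun x => proj x ord0 i).
Proof.
move=> h; apply: (@cts_eq _ _ _ (fun x => (n2 x)^-1 * x ord0 i)).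
  by move=> x _; rewrite mxE.
apply: cts_mul cts_coord; apply: cts_inv (@cts_n2 _) => x /h x0.
by rewrite sqrtr_eq0 -ltNge lt0r x0 sumr_ge0 // => j _; exact: sqr_ge0.
Qed.

Let norm_sq (x : V) : 0 < `|x| -> sq x != 0.
Proof.
move=> x0; have [i hi] := rv_norm_at x0; apply: lt0r_neq0.
apply: lt_le_trans (sq_ge x i); rewrite exprn_even_gt0 //=.
by rewrite -normr_eq0 hi gt_eqF.
Qed.

(** The map is extended radially to the boundary of the cube [[-1, 1]^(k+1)] and filled there. The
    filling, shrunk by the factor [K], is used on a small cube inside the ball; outside that cube
    the map is [f] after radial projection. *)
Lemma sphere_fill f : pcon R e m S -> k%:Z <= m -> cmap e sphere S f ->
  exists g, cmap e disk S g /\ forall x, sphere x -> g x = f x.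
Proof.
(* This inequality places the cube of half side [1/K] in the open unit ball. *)
have [K [K0 Kk]] : exists K : R, 0 < K /\ k.+1%:R * K^-1 ^+ 2 < 1.
  exists k.+2%:R; split; first by rewrite ltr0n.
  rewrite expr2 mulrA ltr_pdivrMr ?ltr0n // mul1r ltr_pdivrMr ?ltr0n //.
  by rewrite -natrM ltr_nat; lia.
move=> cS km cf; pose l : V := const_mx (-1); pose u : V := const_mx 1.
have lu i : l ord0 i <= u ord0 i by rewrite !mxE; lra.
have dlu : (bdim l u)%:Z <= m + 1.
  have := max_card [set i | l ord0 i < u ord0 i]%SET.
  by rewrite card_ord /bdim; lia.
have bnorm x : bdry l u x -> 0 < `|x|.
  case=> _ [i [_ xi]]; apply: lt_le_trans (rv_coord_le x i).
  by case: xi => ->; rewrite mxE ?normrN normr1.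
have [|G [cG Gf]] := cS _ l u lu dlu (fun x => f (proj x)).
  apply: cmap_comp cf; first by move=> x /bnorm/norm_sq; exact: proj_sphere.
  by move=> i; apply: cts_proj => x /bnorm/norm_sq.
pose D1 := disk `&` [set x | 0 <= `|x| - K^-1].
pose D2 := disk `&` [set x | 0 <= K^-1 - `|x|].
have diskc : closed disk.
  rewrite (_ : disk = [set x | 0 <= 1 - sq x]).
    by apply: closed_cts_ge; exact: (cts_sub cts_cst (@cts_sq _)).
  by apply/seteqP; split=> x /=; rewrite /disk /= subr_ge0.
have ctsn D : cts D (fun x : V => `|x|).
  by apply: (@cts_rv_norm _ _ _ _ id) => i; exact: cts_coord.
have D1c : closed D1.
  by apply: closedI => //; apply: closed_cts_ge; exact: (cts_sub (ctsn _) cts_cst).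
have D2c : closed D2.
  by apply: closedI => //; apply: closed_cts_ge; exact: (cts_sub cts_cst (ctsn _)).
have Ki : 0 < K^-1 by rewrite invr_gt0.
have D1s x : D1 x -> sq x != 0.
  by move=> [_ /= h]; apply: norm_sq; lra.
have c1 : cmap e D1 S (fun x => f (proj x)).
  apply: cmap_comp cf; first by move=> x /D1s; exact: proj_sphere.
  by move=> i; exact: cts_proj.
have boxE x : `|x| <= K^-1 -> box l u (K *: x).
  move=> h i; rewrite !mxE -ler_norml normrM (gtr0_norm K0).
  by rewrite mulrC -ler_pdivlMr // mul1r; apply: le_trans h; exact: rv_coord_le.
have c2 : cmap e D2 S (fun x => G (K *: x)).
  apply: cmap_comp cG; first by move=> x [_ /= h]; apply: boxE; lra.
  move=> i; apply: (@cts_eq _ _ _ (fun x => K * x ord0 i)).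
    by move=> x _; rewrite mxE.
  exact: cts_mul cts_cst cts_coord.
have [|h [ch h1 h2]] := cmap_glue D1c D2c c1 c2.
  move=> x [_ /= a1] [_ /= a2]; have xK : `|x| = K^-1 by lra.
  rewrite Gf ?proj_scale //; split; first by apply: boxE; rewrite xK.
  have [i hi] := @rv_norm_at _ _ x ltac:(by rewrite xK).
  exists i; split; first by rewrite !mxE; lra.
  rewrite !mxE; move: hi; rewrite xK; have [y0|y0] := lerP 0 (x ord0 i).
    by rewrite ger0_norm // => ->; right; rewrite divff // gt_eqF.
  rewrite ltr0_norm // => hi; left; rewrite -[x ord0 i]opprK hi mulrN divff //.
  by rewrite gt_eqF.
exists h; split.
  apply: cmap_sub ch => // x dx.
  by have [hx|hx] := lerP `|x| K^-1; [right|left]; split=> //=; lra.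
move=> x sx; rewrite h1 ?proj_id //; split; first by rewrite /disk /= sx.
rewrite /= subr_ge0 leNgt; apply/negP => hx.
have : sq x <= \sum_(i < k.+1) K^-1 ^+ 2.
  apply: ler_sum => i _; rewrite -[leLHS]real_normK ?num_real //.
  by rewrite lerXn2r ?nnegrE ?(ltW Ki) //; apply: le_trans (ltW hx); exact: rv_coord_le.
rewrite sx sumr_const card_ord; apply/negP; rewrite -ltNge.
by rewrite -mulr_natl.
Qed.
End Sphere.

End Soundness.

(** * Flag complexes as simplicial complexes *)

Section FlagComplex.
Variables (T : choiceType) (e : T -> T -> Prop).
Hypothesis esym : forall u v, e u v -> e v u.
Hypothesis erefl : forall u, e u u.
Implicit Types (S : set T) (m : int).

Definition flag_complex S : set (set T) :=
  [set s | [/\ s !=set0, finite_set s, s `<=` S & forall t u, s t -> s u -> e t u]].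

Lemma pt_realization S (a : T -> RR) (E : seq T) :
  pt e S a -> uniq E -> (forall t, a t != 0 -> t \in E) ->
  \sum_(t <- E) a t = 1 -> realization (flag_complex S) a.
Proof.
move=> [a0 [t0 at0] aS acl] uE aE a1; split=> //.
pose s := [seq t <- E | a t != 0].
have us : uniq s by exact: filter_uniq.
have ms t : (t \in s) = (a t != 0).
  by rewrite mem_filter; case: (boolP (a t != 0)) => // /aE.
exists (size s), (fun i => tnth (in_tuple s) i).
have rs : [set t | a t != 0] = range (fun i => tnth (in_tuple s) i).
  apply/seteqP; split=> t /=.
    by rewrite -ms => /(tnthP (in_tuple s) t)[i ->]; exists i.
  by case=> i _ <-; rewrite -ms; exact: mem_tnth.
split=> //.
- by move=> i j; apply: tuple_uniqP.
- rewrite -rs; split.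
  + by exists t0.
  + by apply/finite_seqP; exists s; apply/seteqP; split=> t /=; rewrite ms.
  + by move=> t; exact: aS.
  + by move=> t u; exact: acl.
- have := big_tnth 0 +%R s xpredT (fun t => a t); rewrite /= => <-.
  rewrite big_filter -a1 big_mkcond; apply: eq_bigr => t _.
  by case: eqVneq => [->|].
Qed.

Lemma realization_pt S (a : T -> RR) (E : seq T) :
  realization (flag_complex S) a -> uniq E -> (forall t, a t != 0 -> t \in E) ->
  pt e S a /\ \sum_(t <- E) a t = 1.
Proof.
move=> [a0 [m [f [finj fr [[t0 ft0] _ fS fcl] f1]]]] uE aE; rewrite -fr in ft0 fS fcl.
split; first by split=> //; exists t0.
rewrite -f1 -(big_map f xpredT a) (bigID (fun t => a t != 0)) /= [X in _ + X]big1; last first.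
  by move=> t /negPn/eqP.
rewrite addr0 -big_filter; apply: perm_big; apply: uniq_perm.
- exact: filter_uniq.
- by rewrite map_inj_uniq // /index_enum -enumT enum_uniq.
move=> t; rewrite mem_filter.
have -> : (t \in [seq f i | i <- index_enum 'I_m]) = (a t != 0).
  apply/idP/idP.
    move=> /mapP[i _ ->]; have : range f (f i) by exists i.
    by rewrite -fr.
  move=> h; have : [set t | a t != 0] t by [].
  by rewrite fr => -[i _ <-]; apply: map_f; rewrite mem_index_enum.
by case: (boolP (a t != 0)) => // /aE.
Qed.

Lemma conn_connected_upto m S : conn e m S -> connected_upto (flag_complex S) m.
Proof.
move=> cS; have pS : pcon RR e m S := conn_pcon esym erefl cS.
split.
  move=> hm; have [a [pa [E aE]]] := pcon_nonempty pS hm.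
  have ca : cmap e (setT : set 'rV[RR]_0) S (fun=> a).
    by split=> // [|t]; [exists E => x t _; exact: aE|exact: cts_cst].
  have [E' [g [[gp _ _] uE' gE' g1 _]]] := cmap_normalize esym ca.
  exists (g 0); apply: (pt_realization (gp 0 I) uE') => [t gt|]; last exact: g1.
  by apply: (gE' 0) => //; rewrite gt.
move=> k km f [fr [mm [e0 fe0]] fc].
pose E0 := undup [seq e0 i | i <- enum 'I_mm].
have fE0 x t : sphereR x -> f x t != 0 -> t \in E0.
  move=> sx ft; have := fe0 x sx t ft => -[i _ <-].
  by rewrite mem_undup; apply: map_f; rewrite mem_enum.
have uE0 : uniq E0 by exact: undup_uniq.
have cf : cmap e (@sphereR k) S f.
  split.
  - by move=> x sx; have [] := realization_pt (fr x sx) uE0 (fun t => fE0 x t sx).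
  - by exists E0 => x t; exact: fE0.
  - by move=> t; apply/ctsE.
have [h [ch hf]] := sphere_fill pS km cf.
(* Normalizing the filling leaves it unchanged over the sphere, where the coordinates of [f] already
   sum to [1]. *)
have [E [g [[gp _ gc] uE gE g1 [_ gh]]]] := cmap_normalize esym ch.
exists g; split.
  split.
  - move=> x dx; apply: (pt_realization (gp x dx) uE); last exact: g1.
    by move=> t gt; apply: (gE x) => //; rewrite gt.
  - exists (size E), (fun i => tnth (in_tuple E) i) => x dx t /= gt.
    have /(tnthP (in_tuple E) t)[i ->] : t \in E by apply: (gE x) => //; rewrite gt.
    by exists i.
  - by move=> t; apply/ctsE; exact: gc.
move=> x sx.
have dx : diskR x.
  by move: sx; rewrite /sphereR /diskR /= => ->.
have fE t : f x t != 0 -> t \in E.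
  by move=> ft; apply: (gE x) => //; rewrite hf // ft orbT.
by rewrite gh // hf //; have [_] := realization_pt (fr x sx) uE fE.
Qed.

End FlagComplex.

(** * The stable range condition *)

Definition SR3 (R : comNzRingType) : Prop :=
  forall a b c : R, (exists u v w, u * a + v * b + w * c = 1) ->
  exists s t u v, u * (a + s * c) + v * (b + t * c) = 1.

(** The unit [a - t * (v * b + w * c)] lies in the ideal generated by [a - t * w * c] and [b]. *)
Lemma SR2_SR3 (R : comNzRingType) : SR2 R -> SR3 R.
Proof.
move=> sr a b c [u [v [w h]]].
have [|t [y hy]] := sr a (v * b + w * c); first by exists u, 1; rewrite mul1r addrA.
by exists (- (t * w)), 0, y, (- (t * v * y)); rewrite -hy; ring.
Qed.

(** * Zero-dimensional quotients and unimodular triples *)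

Section PiRegular.
Variable R : comNzRingType.

(* [R / b] is pi-regular, that is, zero-dimensional. *)
Definition pi_regular_mod (b : R) :=
  forall a, exists (N : nat) (r z : R), a ^+ N * (1 - a * r) = b * z.

Lemma pi_regular_mod1 : pi_regular_mod 1.
Proof. by move=> a; exists 0%N, 0, 1; rewrite mulr0 subr0 expr0. Qed.

Lemma pi_regular_modM b b' :
  pi_regular_mod b -> pi_regular_mod b' -> pi_regular_mod (b * b').
Proof.
move=> hb hb' a; have [N [r [z h]]] := hb a; have [N' [r' [z' h']]] := hb' a.
(* Chosen so that [1 - a * (r + r' - a * r * r') = (1 - a * r) * (1 - a * r')]. *)
exists (N + N')%N, (r + r' - a * r * r'), (z * z'); rewrite exprD.
rewrite -[RHS]mulrACA -h -h'; ring.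
Qed.

Lemma pi_regular_mod_dvd b c : pi_regular_mod (b * c) -> pi_regular_mod b.
Proof.
move=> h a; have [N [r [z hz]]] := h a.
by exists N, r, (c * z); rewrite mulrA.
Qed.

Lemma pi_regular_unimodular a b c : pi_regular_mod b ->
  (exists u v w, u * a + v * b + w * c = 1) ->
  exists t u v, u * (a + t * c) + v * b = 1.
Proof.
move=> hb [u [v [w huvw]]]; have [N0 [r [z0 hz0]]] := hb a.
(* Modulo [b], [e] is idempotent, [a] is a unit on its component and nilpotent on the
   complementary one, where therefore [c] is a unit. *)
pose N := N0.+1; pose e := (a * r) ^+ N; exists (1 - e).
pose I x := exists p q, p * (a + (1 - e) * c) + q * b = x.
have ID x y : I x -> I y -> I (x + y).
  by move=> [p [q <-]] [p' [q' <-]]; exists (p + p'), (q + q'); ring.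
have IM k x : I x -> I (k * x).
  by move=> [p [q <-]]; exists (k * p), (k * q); ring.
have Ib k : I (k * b) by exists 0, k; ring.
have Ig : I (a + (1 - e) * c) by exists 1, 0; ring.
have aNe : I (a ^+ N * (1 - e)).
  have [S ->] : exists S, 1 - e = (1 - a * r) * S.
    exists (\sum_(i < N) (a * r) ^+ i).
    by rewrite -opprB -[1 - _]opprB mulNr -subrX1.
  have -> : a ^+ N * ((1 - a * r) * S) = a * S * z0 * b.
    transitivity (a * S * (a ^+ N0 * (1 - a * r))); last by rewrite hz0; ring.
    by rewrite [a ^+ N]exprS; ring.
  exact: Ib.
have Iea : I (e * a).
  have -> : e * a = e * (a + (1 - e) * c) + (- (r ^+ N * c)) * (a ^+ N * (1 - e)).
    by rewrite /e exprMn; ring.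
  by apply: ID; apply: IM.
have Ie : I e.
  have -> : e = (a ^+ N0 * r ^+ N) * (e * a) + r ^+ N * (a ^+ N * (1 - e)).
    by rewrite /e exprMn /N exprS; ring.
  by apply: ID; apply: IM.
have IaN : I (a ^+ N).
  have -> : a ^+ N = a ^+ N * e + 1 * (a ^+ N * (1 - e)) by ring.
  by apply: ID; apply: IM.
have I1a : I (1 - (u - w) * a).
  have -> : 1 - (u - w) * a = v * b + w * (a + (1 - e) * c) + w * c * e.
    by rewrite -[X in X - _ = _]huvw; ring.
  by apply: (ID _ _ (ID _ _ (Ib _) _)); apply: IM.
suff [p [q hpq]] : I 1 by exists p, q.
have -> : 1 = (\sum_(i < N) ((u - w) * a) ^+ i) * (1 - (u - w) * a)
    + (u - w) ^+ N * a ^+ N.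
  have := subrX1 ((u - w) * a) N; rewrite exprMn => h.
  transitivity ((u - w) ^+ N * a ^+ N - ((u - w) ^+ N * a ^+ N - 1)); first by ring.
  by rewrite h; ring.
by apply: ID; apply: IM.
Qed.

End PiRegular.

(** * Subrings of number fields *)

Section NumberField.
Variables (K : fieldExtType rat) (R : comNzRingType) (phi : {rmorphism R -> K}).
Hypothesis phi_inj : injective phi.

Let intrK_eq0 (z : int) : (z%:~R == 0 :> K) = (z == 0).
Proof. by rewrite -(rmorph_int (in_alg K)) fmorph_eq0 intr_eq0. Qed.

(** The minimal polynomial over the rationals, with denominators cleared and the content divided
    out. *)
Lemma primitive_root_poly (x : K) :
  exists q : {poly int}, zcontents q = 1 /\ root (map_poly intr q) x.
Proof.
have /polyOver1P[p hp] := minPolyOver 1%AS x.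
have [q [a a0 pq]] := rat_poly_scale p.
have rq : root (map_poly intr q : {poly K}) x.
  have -> : map_poly intr q = map_poly (in_alg K) (map_poly intr q) :> {poly K}.
    by rewrite -map_poly_comp; apply: eq_map_poly => z; rewrite -[RHS]/(in_alg K z%:~R) rmorph_int.
  have -> : map_poly intr q = a%:~R *: p :> {poly rat}.
    by rewrite pq scalerA divff ?scale1r // intr_eq0.
  by rewrite map_polyZ -hp rootZ ?root_minPoly // fmorph_eq0 intr_eq0.
have q0 : q != 0.
  apply/eqP => q0; have := monic_neq0 (monic_minPoly 1%AS x).
  by rewrite hp pq q0 map_poly0 scaler0 map_poly0 eqxx.
exists (zprimitive q); split; first by rewrite zcontents_primitive q0.
move: rq; rewrite {1}(zpolyEprim q) map_polyZ rootZ //.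
by rewrite intrK_eq0 zcontents_eq0.
Qed.

Lemma root_in_subring (q : {poly int}) a : root (map_poly intr q) (phi a) ->
  (map_poly intr q).[a] = 0 :> R.
Proof.
move=> /rootP h; apply: phi_inj; rewrite rmorph0 -h.
rewrite -horner_map -map_poly_comp; congr horner.
by apply: eq_map_poly => z /=; rewrite rmorph_int.
Qed.

(** A primitive polynomial vanishing at [a] has a coefficient prime to [p]. Let [c] be the lowest
    one, in degree [M]: modulo [p] the relation reads [a ^+ M * (q(a) * a + c) = 0] with [c]
    invertible, which is pi-regularity for [a]. *)
Lemma pi_regular_prime (p : nat) : prime p -> pi_regular_mod (p%:R : R).
Proof.
move=> pp a; have [q [q1 /root_in_subring qa]] := primitive_root_poly (phi a).
have ndiv : ~~ (q \is a polyOver (dvdz p)).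
  by rewrite -dvdz_contents q1 dvdz1 /= neq_ltn prime_gt1 ?orbT.
(* The generalization to [a ^+ M * q(a)] in [p R] is stable under discarding a constant coefficient
   divisible by [p]. *)
suff gen M z : a ^+ M * (map_poly intr q).[a] = p%:R * z ->
    exists (N : nat) (r z : R), a ^+ N * (1 - a * r) = p%:R * z.
  by apply: (gen 0%N 0); rewrite qa !mulr0.
move: {q1 qa} q ndiv M z; apply: poly_ind => [|q c IH] ndiv M z.
  by rewrite rpred0 in ndiv.
rewrite rmorphD rmorphM /= map_polyX map_polyC /= hornerMXaddC => h.
have [/dvdzP[c' cE]|pc] := boolP (p %| c)%Z.
  apply: (IH _ M.+1 (z - c'%:~R * a ^+ M)).
    apply: contra ndiv => qd; apply: rpredD.
      apply/polyOverP => i; rewrite coefMX; case: ifP => _; first exact: rpred0.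
      exact: (polyOverP qd).
    by rewrite polyOverC cE; apply: dvdz_mull; exact: dvdzz.
  rewrite mulrBr -h cE rmorphM /= -pmulrn exprS; ring.
have : coprimez p c by rewrite coprimezE /= prime_coprime.
move=> /coprimezP[[y' y] /= hy].
have hyR : y'%:~R * p%:R + y%:~R * c%:~R = 1 :> R.
  by rewrite -[p%:R]/(p%:Z%:~R) -!intrM -intrD hy.
exists M, (- (y%:~R * (map_poly intr q).[a])), (y%:~R * z + y'%:~R * a ^+ M).
transitivity (y%:~R * (a ^+ M * ((map_poly intr q).[a] * a + c%:~R))
   + p%:R * (y'%:~R * a ^+ M)).
  rewrite -[X in X - _]hyR; ring.
by rewrite h; ring.
Qed.

Lemma pi_regular_nat (n : nat) : (0 < n)%N -> pi_regular_mod (n%:R : R).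
Proof.
elim/ltn_ind: n => n IH n0; have [n1|n1] := leqP n 1.
  by rewrite (_ : n = 1%N); [exact: pi_regular_mod1|lia].
have pn := pdiv_prime n1; have dn := pdiv_dvd n.
rewrite -(divnK dn) natrM; apply: pi_regular_modM; last exact: pi_regular_prime.
by apply: IH; [apply: ltn_Pdiv => //; exact: prime_gt1|rewrite divn_gt0 ?pdiv_gt0 // dvdn_leq].
Qed.

Lemma phi_integral (x y : R) : x * y = 0 -> y != 0 -> x = 0.
Proof.
move=> xy y0; apply: phi_inj; rewrite rmorph0; apply/eqP.
have : phi x * phi y == 0 by rewrite -rmorphM xy rmorph0.
rewrite mulf_eq0 => /orP[//|/eqP hy]; case/eqP: y0; apply: phi_inj.
by rewrite hy rmorph0.
Qed.

(** Some nonzero integer is a multiple of [b]: cancel powers of [b] in an integral relation until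
    its constant coefficient is nonzero. Pi-regularity modulo that integer passes to its divisor
    [b]. *)
Lemma pi_regular_neq0 (b : R) : b != 0 -> pi_regular_mod b.
Proof.
move=> b0; have [q [q1 /root_in_subring qb]] := primitive_root_poly (phi b).
have q0 : q != 0 by apply: contra_eq_neq q1 => ->; rewrite zcontents0.
suff [m [c [m0 hm]]] : exists (m : int) (c : R), m != 0 /\ b * c = m%:~R.
  apply: (@pi_regular_mod_dvd _ _ (c * (sgz m)%:~R)); rewrite mulrA hm -intrM.
  rewrite mulrC -abszEsg -pmulrn; apply: pi_regular_nat.
  by rewrite absz_gt0.
move: {q1} q q0 qb; apply: poly_ind => [|q c IH]; first by rewrite eqxx.
rewrite rmorphD rmorphM /= map_polyX map_polyC /= hornerMXaddC => qc0 h.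
have [c0|c0] := eqVneq c 0.
  move: h; rewrite c0 addr0 => /phi_integral/(_ b0); apply: IH.
  by apply: contraNneq qc0 => ->; rewrite c0 mul0r add0r.
exists c, (- (map_poly intr q).[b]); split=> //.
by apply/eqP; rewrite mulrN mulrC -subr_eq0 -opprD h oppr0.
Qed.

Lemma number_subring_SR3 : SR3 R.
Proof.
move=> a b c huvw; have [b0|b0] := eqVneq b 0; last first.
  have [t [u [v h]]] := pi_regular_unimodular (pi_regular_neq0 b0) huvw.
  by exists t, 0, u, v; rewrite mul0r addr0.
have [a0|a0] := eqVneq a 0; last first.
  have [|t [u [v h]]] := @pi_regular_unimodular _ b a c (pi_regular_neq0 a0).
    by have [u [v [w h]]] := huvw; exists v, u, w; rewrite -h; ring.
  by exists 0, t, v, u; rewrite -h; ring.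
have [u [v [w h]]] := huvw.
by exists w, 0, 1, 0; move: h; rewrite a0 b0 !mulr0 !add0r mul1r mul0r addr0.
Qed.

End NumberField.

Lemma arithmetic_SR3 (R : comNzRingType) : arithmetic_dedekind R -> SR3 R.
Proof.
move=> [K [m [s [phi [_ _ phiDM [phi1 phi_inj] _]]]]].
have phiD a b : phi (a + b) = phi a + phi b by have [] := phiDM a b.
have phiM a b : phi (a * b) = phi a * phi b by have [] := phiDM a b.
have phi0 : phi 0 = 0 by apply: (addrI (phi 0)); rewrite -phiD !addr0.
have phiB : zmod_morphism phi.
  move=> a b; apply: (addIr (phi b)); rewrite -phiD !subrK //.
have phiMm : monoid_morphism phi by [].
pose phiA := GRing.isZmodMorphism.Build R K phi phiB.
pose phiMM := GRing.isMonoidMorphism.Build R K phi phiMm.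
pose psi : {rmorphism R -> K} := HB.pack phi phiA phiMM.
exact: (@number_subring_SR3 K R psi).
Qed.

(** * Completing unimodular columns *)

Section Unimodular.
Variable R : comNzRingType.
Hypothesis sr : SR3 R.

(** All entries of [x] but the first two are absorbed, together with [x0], into the third element
    [y + c0 * x0] of SR3. The shift by multiples of [c0 * x0] goes into [s]; the shift by multiples
    of [y] is recovered by the later entries of [d]. *)
Lemma SR3_column n (x0 : R) (x : 'cV[R]_n.+2) :
  (exists c0 (c : 'rV[R]_n.+2), c0 * x0 + (c *m x) 0 0 = 1) ->
  exists (s : 'cV[R]_n.+2) (d : 'rV[R]_n.+2), d *m (x + x0 *: s) = 1%:M.
Proof.
move=> [c0 [c hc]].
pose a := x 0 0; pose b := x (lift 0 0) 0.
pose y := \sum_(i < n) c 0 (lift 0 (lift 0 i)) * x (lift 0 (lift 0 i)) 0.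
have hc' : c 0 0 * a + c 0 (lift 0 0) * b + 1 * (y + c0 * x0) = 1.
  by rewrite mul1r -hc mxE !big_ord_recl -/a -/b -/y; ring.
have [s [t [u [v huv]]]] := sr (ex_intro _ _ (ex_intro _ _ (ex_intro _ _ hc'))).
exists (\col_i if i == 0 then s * c0 else if i == lift 0 0 then t * c0 else 0).
exists (\row_i (if i == 0 then u else if i == lift 0 0 then v
  else (u * s + v * t) * c 0 i)).
apply/matrixP => i j; rewrite !ord1 !mxE !big_ord_recl !mxE /= -huv.
rewrite (eq_bigr (fun i : 'I_n => (u * s + v * t) *
  (c 0 (lift 0 (lift 0 i)) * x (lift 0 (lift 0 i)) 0))); last first.
  by move=> k _; rewrite !mxE /= mulr0 addr0 mulrA.
by rewrite -mulr_sumr -/y -/a -/b; ring.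
Qed.

(** Length [1] is a unit and length [2] an explicit matrix of determinant [1]. For longer columns,
    adding multiples of the first entry makes the rest unimodular by SR3, and the shorter column is
    treated by induction. *)
Lemma unimodular_column n (x : 'cV[R]_n.+1) : (exists c, c *m x = 1%:M) ->
  exists A B : 'M[R]_n.+1, A *m B = 1%:M /\ A *m x = delta_mx 0 0.
Proof.
elim: n x => [|n IH] x [c hc].
  exists c, x; split=> //; rewrite hc; apply/matrixP => i j.
  by rewrite !ord1 !mxE eqxx.
case: n x c IH hc => [|n] x c IH hc.
  have hc' : c 0 0 * x 0 0 + c 0 1 * x 1 0 = 1.
    have /matrixP/(_ 0 0) := hc; rewrite !mxE !big_ord_recl big_ord0 addr0.
    by rewrite (_ : lift 0 0 = 1) //; apply: val_inj.
  (* The second row completes [c] to a matrix of determinant [1]; [B] below is its adjugate. *)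
  pose A : 'M[R]_2 := \matrix_(i, j)
    if i == 0 then c 0 j else if j == 0 then - x 1 0 else x 0 0.
  pose B : 'M[R]_2 := \matrix_(i, j)
    if j == 0 then x i 0 else if i == 0 then - c 0 1 else c 0 0.
  have E (i : 'I_2) : i = 0 \/ i = 1.
    by case: i => [[|[|//]] hi]; [left|right]; apply: val_inj.
  have S (F : 'I_2 -> R) : \sum_i F i = F 0 + F 1.
    by rewrite !big_ord_recl big_ord0 addr0; congr (_ + F _); apply: val_inj.
  exists A, B; split; apply/matrixP => i j; rewrite !mxE S !mxE.
    by case: (E i) => ->; case: (E j) => -> /=; rewrite -?hc'; ring.
  by rewrite (ord1 j); case: (E i) => -> /=; rewrite -?hc'; ring.
pose x0 : R := x 0 0; pose x' : 'cV[R]_n.+2 := dsubmx (x : 'cV[R]_(1 + n.+2)).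
have xE : x = col_mx x0%:M x' :> 'cV[R]_(1 + n.+2).
  rewrite -[LHS](@vsubmxK _ 1 n.+2 1); congr col_mx.
  by apply/matrixP => i j; rewrite !ord1 !mxE; congr (x _ _); apply: val_inj.
have [|s [d hd]] := @SR3_column n x0 x'.
  exists (c 0 0), (rsubmx (c : 'rV[R]_(1 + n.+2))).
  have /matrixP/(_ 0 0) := hc; rewrite !mxE big_ord_recl /= => h; rewrite -[RHS]h.
  congr (_ + _); apply: eq_bigr => i _; rewrite !mxE.
  by congr (c _ _ * x _ _); apply: val_inj.
have [A [B [AB Ax]]] := IH _ (ex_intro _ d hd).
pose dr : 'M[R]_(1, n.+2) := (1 - x0) *: delta_mx 0 0.
pose dc : 'M[R]_(n.+2, 1) := delta_mx 0 0.
pose lower (y : 'M[R]_(n.+2, 1)) C : 'M[R]_(1 + n.+2) := block_mx 1%:M 0 y C.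
pose upper (y : 'M[R]_(1, n.+2)) : 'M[R]_(1 + n.+2) := block_mx 1%:M y 0 1%:M.
have lowerM y C D : C *m D = 1%:M -> lower y C *m lower (- D *m y) D = 1%:M.
  move=> CD; rewrite mulmx_block !mul1mx !mulmx1 !mul0mx !mulmx0 !addr0 add0r CD.
  by rewrite !mulNmx mulmxN mulmxA CD mul1mx subrr -scalar_mx_block.
have upperM y : upper y *m upper (- y) = 1%:M.
  rewrite mulmx_block !mul1mx !mulmx1 !mul0mx !mulmx0 !addr0 add0r.
  by rewrite addrC subrr -scalar_mx_block.
have [y yE] : exists y, y = A *m s by exists (A *m s).
(* Read from the right, the column becomes [(x0, e)], then [(1, e)], then [(1, 0)], where [e] is the
   first unit vector [dc]. *)
exists (lower (- dc) 1%:M *m (upper dr *m lower y A)).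
exists (lower (- B *m y) B *m (upper (- dr) *m lower (- 1%:M *m - dc) 1%:M)).
split.
  rewrite !mulmxA -(mulmxA _ (lower y A)) lowerM // mulmx1.
  by rewrite -(mulmxA _ (upper dr)) upperM mulmx1 lowerM // mulmx1.
have H1 : lower y A *m col_mx x0%:M x' = col_mx x0%:M dc.
  rewrite mul_block_col mul1mx mul0mx addr0 yE mul_mx_scalar scalemxAr -mulmxDr.
  by rewrite [x0 *: s + x']addrC Ax.
have H2 : upper dr *m col_mx x0%:M dc = col_mx 1%:M dc.
  rewrite mul_block_col !mul1mx mul0mx add0r -scalemxAl mul_delta_mx; congr col_mx.
  apply/matrixP => i j; rewrite !ord1 !mxE !eqxx.
  by rewrite !mulr1n mulr1 addrC subrK.
have H3 : lower (- dc) 1%:M *m col_mx 1%:M dc = col_mx 1%:M 0.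
  by rewrite mul_block_col !mul1mx mul0mx addr0 mulmx1 addNr.
have H : lower (- dc) 1%:M *m (upper dr *m (lower y A *m col_mx x0%:M x'))
  = col_mx 1%:M 0 by rewrite H1 H2 H3.
rewrite -!mulmxA xE; apply: (etrans H).
apply/matrixP => i j; rewrite !mxE (ord1 j) andbT.
case: (@splitP 1 n.+2 i) => k hk.
  have -> : i = 0 by apply: val_inj; rewrite /= hk (ord1 k).
  by rewrite (ord1 k) mxE.
by rewrite mxE; case: eqP hk => // ->.
Qed.

End Unimodular.

(** * Free extensions of submodules *)

Section Extensions.
Variables (R : comNzRingType) (M : lmodType R).
Implicit Types (V W U : set M) (f g : M -> R).

Definition subm V : Prop :=
  [/\ V 0, forall u v, V u -> V v -> V (u + v) & forall a v, V v -> V (a *: v)].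

Definition lincomb n (b : 'I_n -> M) (c : 'I_n -> R) := \sum_i c i *: b i.

(* [W / V] is free, with basis the classes of [b]. *)
Definition ext_basis V W n (b : 'I_n -> M) : Prop :=
  (forall w, W w <-> exists v c, V v /\ w = v + lincomb b c) /\
  (forall c, V (lincomb b c) -> forall i, c i = 0).

Definition ext V W n := exists b : 'I_n -> M, ext_basis V W b.

(** Functionals on a submodule are total functions constrained only on [W], so restricting to a
    smaller submodule does not change the function. *)
Definition linear_on W f := forall a u v, W u -> W v -> f (a *: u + v) = a * f u + f v.

Lemma subm0 V : subm V -> V 0. Proof. by case. Qed.
Lemma submD V u v : subm V -> V u -> V v -> V (u + v). Proof. by case=> _ + _; exact. Qed.
Lemma submZ V a v : subm V -> V v -> V (a *: v). Proof. by case=> _ _; exact. Qed.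
Lemma submN V v : subm V -> V v -> V (- v).
Proof. by move=> sV Vv; rewrite -scaleN1r; exact: submZ. Qed.
Lemma submB V u v : subm V -> V u -> V v -> V (u - v).
Proof. by move=> sV Vu Vv; apply: submD => //; exact: submN. Qed.
Lemma subm_comb V n (b : 'I_n -> M) c : subm V -> (forall i, V (b i)) -> V (lincomb b c).
Proof.
move=> sV hb; rewrite /lincomb; elim/big_ind: _ => //; first exact: subm0.
  by move=> u v; exact: submD.
by move=> i _; exact: submZ.
Qed.

Lemma linear_on0 W f : subm W -> linear_on W f -> f 0 = 0.
Proof.
move=> sW lf; have := lf (-1) 0 0 (subm0 sW) (subm0 sW).
by rewrite scaler0 addr0 mulN1r addNr.
Qed.

Lemma linear_onD W f u v : linear_on W f -> W u -> W v -> f (u + v) = f u + f v.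
Proof. by move=> lf Wu Wv; have := lf 1 u v Wu Wv; rewrite scale1r mul1r. Qed.

Lemma linear_onZ W f a u : subm W -> linear_on W f -> W u -> f (a *: u) = a * f u.
Proof.
move=> sW lf Wu; have := lf a u 0 Wu (subm0 sW).
by rewrite addr0 (linear_on0 sW lf) addr0.
Qed.

Lemma linear_onB W f u v : subm W -> linear_on W f -> W u -> W v -> f (u - v) = f u - f v.
Proof.
move=> sW lf Wu Wv; rewrite (linear_onD lf) //; last exact: submN.
by rewrite -scaleN1r (linear_onZ _ sW lf) // mulN1r.
Qed.

Lemma linear_on_comb W f n (b : 'I_n -> M) c : subm W -> linear_on W f ->
  (forall i, W (b i)) -> f (lincomb b c) = \sum_i c i * f (b i).
Proof.
move=> sW lf hb; pose P (u : M) (a : R) := W u /\ f u = a.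
suff [] : P (lincomb b c) (\sum_i c i * f (b i)) by [].
rewrite /lincomb; elim/big_rec2: _ => [|i y x _ [Wx fx]].
  by split; [exact: subm0|exact: linear_on0 lf].
split; first by apply: submD => //; exact: submZ.
by rewrite lf // fx.
Qed.

Lemma linear_on_sub V W f : V `<=` W -> linear_on W f -> linear_on V f.
Proof. by move=> VW lf a u v /VW Wu /VW Wv; exact: lf. Qed.

Lemma subm_ker W f : subm W -> linear_on W f -> subm (W `&` [set w | f w = 0]).
Proof.
move=> sW lf; split=> [|u v [Wu /= fu] [Wv /= fv]|a v [Wv /= fv]].
- by split; [exact: subm0|exact: linear_on0 lf].
- by split; [exact: submD|rewrite /= (linear_onD lf) // fu fv addr0].
- by split; [exact: submZ|rewrite /= (linear_onZ _ sW lf) // fv mulr0].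
Qed.

Lemma lincombD n (b : 'I_n -> M) c c' :
  lincomb b (fun i => c i + c' i) = lincomb b c + lincomb b c'.
Proof. by rewrite -big_split; apply: eq_bigr => i _; rewrite scalerDl. Qed.

Lemma lincombZ n (b : 'I_n -> M) a c :
  lincomb b (fun i => a * c i) = a *: lincomb b c.
Proof. by rewrite scaler_sumr; apply: eq_bigr => i _; rewrite scalerA. Qed.

Lemma lincombB n (b : 'I_n -> M) c c' :
  lincomb b (fun i => c i - c' i) = lincomb b c - lincomb b c'.
Proof. by rewrite -sumrB; apply: eq_bigr => i _; rewrite scalerBl. Qed.

Lemma lincomb_delta n (b : 'I_n -> M) j : lincomb b (fun i => (i == j)%:R) = b j.
Proof.
rewrite /lincomb (bigD1 j) //= eqxx scale1r big1 ?addr0 // => i /negbTE->.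
by rewrite scale0r.
Qed.

Lemma ext_basis_sub V W n (b : 'I_n -> M) : ext_basis V W b -> V `<=` W.
Proof.
move=> [h _] v Vv; apply/h; exists v, (fun=> 0); split=> //.
by rewrite /lincomb big1 ?addr0 // => i _; rewrite scale0r.
Qed.

Lemma ext_basis_in V W n (b : 'I_n -> M) i : subm V -> ext_basis V W b -> W (b i).
Proof.
move=> sV [h _]; apply/h; exists 0, (fun j => (j == i)%:R); split; first exact: subm0.
by rewrite lincomb_delta add0r.
Qed.

Lemma ext_basis_subm V W n (b : 'I_n -> M) : subm V -> ext_basis V W b -> subm W.
Proof.
move=> sV hb; have [h _] := hb; split.
- by apply: (ext_basis_sub hb); exact: subm0.
- move=> u v /h[u0 [c [Vu ->]]] /h[v0 [c' [Vv ->]]]; apply/h.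
  exists (u0 + v0), (fun i => c i + c' i); split; first exact: submD.
  by rewrite lincombD addrACA.
- move=> a v /h[v0 [c [Vv ->]]]; apply/h.
  exists (a *: v0), (fun i => a * c i); split; first exact: submZ.
  by rewrite lincombZ scalerDr.
Qed.

Lemma ext_sub V W n : ext V W n -> V `<=` W.
Proof. by case=> b /ext_basis_sub. Qed.

Lemma ext_subm V W n : subm V -> ext V W n -> subm W.
Proof. by move=> sV [b /(ext_basis_subm sV)]. Qed.

Lemma ext0_eq V W : ext V W 0 -> V = W.
Proof.
case=> b hb; apply/seteqP; split; first exact: ext_basis_sub hb.
move=> w /(proj1 hb)[v [c [Vv ->]]].
by rewrite /lincomb big_ord0 addr0.
Qed.

Lemma ext_refl V : ext V V 0.
Proof.
exists (fun=> 0); split=> [w|c _ []//]; split.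
  by move=> Vw; exists w, (fun=> 0); rewrite /lincomb big_ord0 addr0.
by move=> [v [c [Vv ->]]]; rewrite /lincomb big_ord0 addr0.
Qed.

Lemma ext_trans V W U n m : subm V -> ext V W n -> ext W U m -> ext V U (n + m).
Proof.
move=> sV [b hb] [b' hb'].
pose bb (i : 'I_(n + m)) := match fintype.split i with inl j => b j | inr j => b' j end.
have E c : lincomb bb c = lincomb b (fun i => c (lshift m i)) +
    lincomb b' (fun i => c (rshift n i)).
  rewrite /lincomb big_split_ord /=; congr (_ + _); apply: eq_bigr => i _.
    by rewrite /bb (unsplitK (inl _ i)).
  by rewrite /bb (unsplitK (inr _ i)).
have sW := ext_basis_subm sV hb.
exists bb; split.
  move=> u; split.
    move=> /(proj1 hb')[w [c' [/(proj1 hb)[v [c [Vv ->]]] ->]]].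
    exists v, (fun i => match fintype.split i with inl j => c j | inr j => c' j end).
    split=> //; rewrite E addrA; congr (_ + _ + _); apply: eq_bigr => i _.
      by rewrite (unsplitK (inl _ i)).
    by rewrite (unsplitK (inr _ i)).
  move=> [v [c [Vv ->]]]; rewrite E addrA; apply/(proj1 hb').
  exists (v + lincomb b (fun i => c (lshift m i))), (fun i => c (rshift n i)).
  by split=> //; apply/(proj1 hb); exists v, (fun i => c (lshift m i)).
move=> c; rewrite E => Vc.
have c2 := proj2 hb' (fun i => c (rshift n i)).
have Wc : W (lincomb b' (fun i => c (rshift n i))).
  rewrite -[X in W X](addKr (lincomb b (fun i => c (lshift m i)))).
  rewrite addrC; apply: submB => //; first exact: (ext_basis_sub hb).
  by apply: subm_comb => // i; exact: ext_basis_in hb.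
have {}c2 := c2 Wc.
have c1 : forall i, c (lshift m i) = 0.
  apply: (proj2 hb (fun i => c (lshift m i))).
  have h0 : lincomb b' (fun i => c (rshift n i)) = 0.
    by rewrite /lincomb big1 // => i _; rewrite c2 scale0r.
  by move: Vc; rewrite h0 addr0.
by move=> i; rewrite -(splitK i); case: (fintype.split i) => j /=; [exact: c1|exact: c2].
Qed.

(** Coordinates modulo [V], chosen pointwise; independence modulo [V] makes them unique on [W], and
    linearity follows from uniqueness. *)
Lemma ext_coord V W n (b : 'I_n -> M) : subm V -> ext_basis V W b ->
  exists k : 'I_n -> M -> R,
    [/\ forall i, linear_on W (k i), forall i v, V v -> k i v = 0,
      forall i j, k i (b j) = (i == j)%:R &
      forall w, W w -> V (w - lincomb b (fun i => k i w))].
Proof.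
move=> sV hb; have sW := ext_basis_subm sV hb.
have /choice[c hc] : forall w, exists c, W w -> V (w - lincomb b c).
  move=> w; have [Ww|nWw] := pselect (W w); last by exists (fun=> 0).
  have [v [c [Vv ->]]] := proj1 (proj1 hb w) Ww.
  by exists c => _; rewrite addrK.
have uniq w c' : W w -> V (w - lincomb b c') -> forall i, c w i = c' i.
  move=> Ww h i; apply/eqP; rewrite -subr_eq0; apply/eqP.
  apply: (proj2 hb (fun i => c w i - c' i)); rewrite lincombB.
  have -> : lincomb b (c w) - lincomb b c' = (w - lincomb b c') - (w - lincomb b (c w)).
    by rewrite opprB [RHS]addrC addrA subrK.
  by apply: submB => //; exact: hc.
exists (fun i w => c w i); split.
- move=> i a u v Wu Wv.
  apply: (uniq _ (fun i => a * c u i + c v i)); first by apply: submD => //; exact: submZ.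
  rewrite lincombD lincombZ opprD addrACA -scalerBr.
  by apply: submD => //; [apply: submZ => //; exact: hc|exact: hc].
- move=> i v Vv; apply: (uniq _ (fun=> 0)); first exact: (ext_basis_sub hb).
  by rewrite /lincomb big1 ?subr0 // => j _; rewrite scale0r.
- move=> i j; apply: (uniq _ (fun i => (i == j)%:R)); first exact: ext_basis_in hb.
  by rewrite lincomb_delta subrr; exact: subm0.
- exact: hc.
Qed.

(** The two base change matrices multiply to the identity, which over a commutative nonzero ring
    bounds one size by the other. *)
Lemma ext_uniq V W n m : subm V -> ext V W n -> ext V W m -> n = m.
Proof.
move=> sV; suff le n' m' : ext V W n' -> ext V W m' -> (n' <= m')%N.
  by move=> h1 h2; apply/eqP; rewrite eqn_leq !le.
move=> [b hb] [b' hb']; have sW := ext_basis_subm sV hb.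
have [k [kl kV kb kW]] := ext_coord sV hb; have [k' [kl' kV' kb' kW']] := ext_coord sV hb'.
apply: (@mulmx1_min R n' m' (\matrix_(i, j) k' j (b i)) (\matrix_(i, j) k j (b' i))).
have Wb i : W (b i) by exact: ext_basis_in hb.
have Wb' i : W (b' i) by exact: ext_basis_in hb'.
apply/matrixP => i j; rewrite !mxE eq_sym -kb.
rewrite -[b i in RHS](subrK (lincomb b' (fun l => k' l (b i)))).
rewrite (linear_onD (kl j)); last exact: subm_comb.
  rewrite kV ?add0r; last exact: kW'.
  rewrite (linear_on_comb _ sW (kl j)) //.
  by apply: eq_bigr => l _; rewrite !mxE.
by apply: submB => //; exact: subm_comb.
Qed.

Lemma ext_ker1 W f u : subm W -> linear_on W f -> W u -> f u = 1 ->
  ext (W `&` [set w | f w = 0]) W 1.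
Proof.
move=> sW lf Wu fu; exists (fun=> u); split.
  move=> w; split.
    move=> Ww; exists (w - f w *: u), (fun=> f w); rewrite /lincomb big_ord1 subrK.
    split=> //; split; first by apply: submB => //; exact: submZ.
    rewrite /= (linear_onB sW lf) //; last exact: submZ.
    by rewrite (linear_onZ _ sW lf) // fu mulr1 subrr.
  move=> [v [c [[Wv _] ->]]]; apply: submD => //.
  by rewrite /lincomb big_ord1; exact: submZ.
move=> c [_ /=]; rewrite /lincomb big_ord1 (linear_onZ _ sW lf) // fu mulr1.
by move=> c0 i; rewrite (ord1 i).
Qed.

(** * Kernels of surjective functionals and cancellation *)

Section Hermite.
Hypothesis sr : SR3 R.

(** The values of [f] on a basis form a unimodular column; completing it gives a basis in which [f]
    is the first coordinate, so the other basis vectors span the kernel modulo [V]. *)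
Lemma ext_ker V W n f u : subm V -> ext V W n.+1 -> linear_on W f ->
  (forall v, V v -> f v = 0) -> W u -> f u = 1 ->
  ext V (W `&` [set w | f w = 0]) n.
Proof.
move=> sV [b hb] lf fV Wu fu; have sW := ext_basis_subm sV hb.
have Wb i : W (b i) by exact: ext_basis_in hb.
pose x : 'cV[R]_n.+1 := \col_i f (b i).
have [|A [B [AB Ax]]] := unimodular_column sr (x := x).
  have [v [c [Vv uE]]] := proj1 (proj1 hb u) Wu.
  exists (\row_i c i); apply/matrixP => i j; rewrite !ord1 !mxE eqxx mulr1n -fu uE.
  rewrite (linear_onD lf) ?(fV v) ?add0r //; last exact: subm_comb.
    by rewrite (linear_on_comb _ sW lf) //; apply: eq_bigr => k _; rewrite !mxE.
  exact: (ext_basis_sub hb).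
have BA := mulmx1C AB.
pose b' i := lincomb b (fun j => A i j).
have combA c : lincomb b' c = lincomb b (fun j => ((\row_i c i) *m A) 0 j).
  rewrite /lincomb /b'; under eq_bigr do rewrite /lincomb scaler_sumr.
  rewrite exchange_big; apply: eq_bigr => j _; rewrite mxE scaler_suml.
  by apply: eq_bigr => i _; rewrite mxE scalerA.
have Wb' i : W (b' i) by exact: subm_comb.
have fb' i : f (b' i) = (i == 0)%:R.
  rewrite (linear_on_comb _ sW lf) //.
  have /matrixP/(_ i 0) := Ax; rewrite !mxE eqxx andbT => <-.
  by apply: eq_bigr => j _; rewrite mxE.
have hb' : ext_basis V W b'.
  split.
    move=> w; split.
      move=> /(proj1 hb)[v [c [Vv ->]]].
      exists v, (fun i => ((\row_j c j) *m B) 0 i); split=> //; congr (_ + _).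
      rewrite combA (_ : \row_i _ = (\row_j c j) *m B); last first.
        by apply/rowP => i; rewrite !mxE.
      by rewrite -mulmxA BA mulmx1; apply: eq_bigr => i _; rewrite mxE.
    move=> [v [c [Vv ->]]]; rewrite combA; apply/(proj1 hb).
    by exists v, (fun j => ((\row_i c i) *m A) 0 j).
  move=> c; rewrite combA => /(proj2 hb) h i.
  have : (\row_i c i) *m A = 0 by apply/rowP => j; rewrite h mxE.
  move=> /(congr1 (fun z => z *m B)); rewrite mul0mx -mulmxA AB mulmx1.
  by move=> /rowP/(_ i); rewrite !mxE.
have comb0 c : lincomb b' c = c 0 *: b' 0 + lincomb (fun i => b' (lift 0 i)) (fun i => c (lift 0 i)).
  by rewrite /lincomb big_ord_recl.
have fcomb c : f (lincomb b' c) = c 0.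
  rewrite (linear_on_comb _ sW lf) // big_ord_recl fb' eqxx mulr1 big1 ?addr0 // => i _.
  by rewrite fb' mulr0.
exists (fun i => b' (lift 0 i)); split.
  move=> w; split.
    move=> [/(proj1 hb')[v [c [Vv ->]]] /=].
    rewrite (linear_onD lf) ?(fV v) ?add0r //; last 2 first.
    - exact: (ext_basis_sub hb).
    - exact: subm_comb.
    rewrite fcomb => c0; exists v, (fun i => c (lift 0 i)).
    by rewrite comb0 c0 scale0r add0r.
  move=> [v [c [Vv ->]]].
  pose c' (i : 'I_n.+1) := match unlift 0 i with Some j => c j | None => 0 end.
  have c'0 : c' 0 = 0 by rewrite /c' unlift_none.
  have cE : lincomb (fun i => b' (lift 0 i)) c = lincomb b' c'.
    rewrite comb0 c'0 scale0r add0r; apply: eq_bigr => i _.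
    by rewrite /c' liftK.
  rewrite cE; have Wv : W v by exact: (ext_basis_sub hb).
  split; first by apply: submD => //; exact: subm_comb.
  rewrite /= (linear_onD lf) ?(fV v) ?fcomb ?c'0 ?addr0 //; exact: subm_comb.
move=> c; pose c' (i : 'I_n.+1) := match unlift 0 i with Some j => c j | None => 0 end.
have cE : lincomb (fun i => b' (lift 0 i)) c = lincomb b' c'.
  rewrite comb0 /c' unlift_none scale0r add0r; apply: eq_bigr => i _.
  by rewrite liftK.
by rewrite cE => /(proj2 hb') h i; have := h (lift 0 i); rewrite /c' liftK.
Qed.

(** Stably free quotients are free: a coordinate functional of [U] over [W] also vanishes on [V],
    and passing to its kernel lowers both ranks by one. *)
Lemma ext_cancel V W U n s : subm V -> subm W -> V `<=` W -> ext V U n -> ext W U s ->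
  exists r, n = (r + s)%N /\ ext V W r.
Proof.
move=> sV sW VW; elim: s U n => [|s IH] U n hVU hWU.
  by exists n; rewrite addn0 (ext0_eq hWU).
have [b hb] := hWU; have [k [kl kW kb _]] := ext_coord sW hb.
have Ub : U (b 0) by exact: ext_basis_in hb.
have kb0 : k 0 (b 0) = 1 by rewrite kb eqxx.
case: n hVU => [|n] hVU.
  have := kb0; rewrite (kW 0 (b 0)); last by apply: VW; rewrite (ext0_eq hVU).
  by move=> /esym/eqP; rewrite oner_eq0.
have [||r [-> hr]] := IH (U `&` [set w | k 0 w = 0]) n.
- by apply: ext_ker hVU _ _ Ub kb0 => // v /VW; exact: kW.
- by apply: ext_ker hWU _ _ Ub kb0 => // v; exact: kW.
- by exists r; rewrite addnS.
Qed.

End Hermite.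
End Extensions.

(** * Intervals of submodules with free quotient *)

Section Intervals.
Variables (R : comNzRingType) (M : lmodType R).
Hypothesis sr : SR3 R.
Implicit Types (V W U : set M) (f g : M -> R) (I : set R).

Definition cmp U W := U `<=` W \/ W `<=` U.

(** The vertices of the Tits complex together with the two end points, zero and the whole module. *)
Definition obj W := subm W /\ exists s, ext W setT s.

(** Strictly decreasing along proper inclusions of [obj], and hence the rank function for attaching.
    The default [0] is taken when no quotient basis exists. *)
Definition corank W : nat := xget 0%N [set s | ext W setT s].

Lemma cmp_sym U W : cmp U W -> cmp W U. Proof. by case; [right|left]. Qed.
Lemma cmp_refl U : cmp U U. Proof. by left. Qed.

Lemma corankE W s : subm W -> ext W setT s -> corank W = s.
Proof.
move=> sW hs; apply: (ext_uniq sW _ hs).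
exact: (@xgetPex _ 0%N [set s | ext W setT s] (ex_intro _ s hs)).
Qed.

Lemma obj_corank W : obj W -> ext W setT (corank W).
Proof. by move=> [sW [s hs]]; rewrite (corankE sW hs). Qed.

Lemma obj_ext V W : obj V -> obj W -> V `<=` W ->
  exists r, corank V = (r + corank W)%N /\ ext V W r.
Proof.
move=> oV oW VW.
exact: (ext_cancel sr (proj1 oV) (proj1 oW) VW (obj_corank oV) (obj_corank oW)).
Qed.

Lemma obj_of_ext V W r : subm V -> ext V W r -> obj W -> obj V.
Proof.
by move=> sV hr oW; split=> //; exists (r + corank W)%N; apply: (ext_trans sV hr (obj_corank oW)).
Qed.

Lemma corank_le V W : obj V -> obj W -> V `<=` W -> (corank W <= corank V)%N.
Proof. by move=> oV oW /(obj_ext oV oW)[r [-> _]]; rewrite leq_addl. Qed.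

Lemma corank_inj V W : obj V -> obj W -> V `<=` W -> corank V = corank W -> V = W.
Proof.
move=> oV oW VW h; have [r [hr e]] := obj_ext oV oW VW.
by apply: ext0_eq; rewrite (_ : 0%N = r) //; lia.
Qed.

Lemma corank_lt V W : obj V -> obj W -> V `<` W -> (corank W < corank V)%N.
Proof.
move=> oV oW [VW nWV]; have := corank_le oV oW VW; rewrite leq_eqVlt => /orP[/eqP h|//].
by case: nWV; rewrite (corank_inj oV oW VW).
Qed.

Lemma cmp_corank_inj V W : obj V -> obj W -> cmp V W -> corank V = corank W -> V = W.
Proof.
move=> oV oW [h|h] c; first exact: corank_inj.
by apply/esym; apply: corank_inj.
Qed.

Lemma conn_join_below a b (L Up : set (set M)) W :
  (forall U, L U -> obj U /\ U `<` W) -> (forall U, Up U -> W `<` U) -> obj W ->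
  (exists N, forall U, L U -> (corank U < N)%N) ->
  conn cmp a L -> conn cmp b Up -> conn cmp (a + b + 2) (L `|` Up).
Proof.
move=> hL hUp oW [N hN]; apply: (conn_join hN).
- by move=> U U' /hL[oU _] /hL[oU' _]; exact: cmp_corank_inj.
- by move=> U U' /hL[_ [UW _]] /hUp[WU _]; left; exact: subset_trans WU.
- by move=> U /hL[_ [UW nWU]] /hUp[_ nUW].
Qed.

(** Attachment is by increasing rank over [V0]. When [W] arrives, all of [X] below [W] is present,
    but above [W] only [A]. The join of the two parts must be [(m-1)]-connected, whence
    [a + b + 3 = m]. *)
Lemma conn_attach_objs (m : int) V0 (A X : set (set M)) :
  obj V0 -> (forall W, X W -> obj W /\ V0 `<=` W) -> A `<=` X -> conn cmp m A ->
  (forall W, X W -> ~ A W -> exists a b : int, [/\ a + b + 3 = m,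
     conn cmp a [set U | X U /\ U `<` W] & conn cmp b [set U | A U /\ W `<` U]]) ->
  conn cmp m X.
Proof.
move=> oV0 hX AX cA hW.
have cV0 W : X W -> (corank W < (corank V0).+1)%N.
  by move=> /hX[oW V0W]; rewrite ltnS; exact: corank_le.
pose rho W := (corank V0 - corank W)%N.
apply: (conn_attach_ranked (rho := rho) (b := (corank V0).+1) cA AX).
- by move=> v _ _; rewrite ltnS leq_subr.
- move=> u v Xu Xv _ _ uv; have := cV0 u Xu; have := cV0 v Xv.
  have [ou _] := hX u Xu; have [ov _] := hX v Xv.
  by rewrite /rho => h1 h2 h3; apply: cmp_corank_inj => //; lia.
move=> W XW nAW; have [a [b [ab ca cb]]] := hW W XW nAW.
have [oW V0W] := hX W XW.
have -> : [set U | [/\ X U, cmp W U & A U \/ (rho U < rho W)%N]] =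
    [set U | X U /\ U `<` W] `|` [set U | A U /\ W `<` U].
  apply/seteqP; split=> U /=.
    move=> [XU cWU h]; have [oU _] := hX U XU.
    have [e|WU] := pselect (U = W).
      by case: h; [rewrite e|rewrite e ltnn].
    case: cWU => cWU; last first.
      by left; split=> //; split=> // h'; apply: WU; apply/seteqP.
    have WpU : W `<` U by split=> // h'; apply: WU; apply/seteqP.
    case: h => [AU|h]; first by right.
    have := corank_le oW oU cWU; have := cV0 U XU; have := cV0 W XW.
    by move: h; rewrite /rho; lia.
  move=> [[XU UW]|[AU WU]].
    have [oU _] := hX U XU; split=> //; first by right; case: UW.
    right; have := corank_lt oU oW UW; have := cV0 U XU; have := cV0 W XW.
    by rewrite /rho; lia.
  by split; [exact: AX|left; case: WU|left].
have -> : m - 1 = a + b + 2 by lia.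
apply: (conn_join_below (W := W)) => //.
- by move=> U [/hX[]].
- by move=> U [].
- by exists (corank V0).+1 => U [/cV0].
Qed.

Definition ideal I :=
  [/\ I 0, forall x y, I x -> I y -> I (x + y) & forall a x, I x -> I (a * x)].

Lemma idealB I x y : ideal I -> I x -> I y -> I (x - y).
Proof.
by move=> [_ ID IM] Ix Iy; apply: ID => //; rewrite -mulN1r; exact: IM.
Qed.

Lemma ideal_image W f : subm W -> linear_on W f -> ideal [set f w | w in W].
Proof.
move=> sW lf; split.
- by exists 0; [exact: subm0|exact: linear_on0 lf].
- move=> _ _ [u Wu <-] [v Wv <-]; exists (u + v); first exact: submD.
  by rewrite (linear_onD lf).
- move=> a _ [u Wu <-]; exists (a *: u); first exact: submZ.
  by rewrite (linear_onZ _ sW lf).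
Qed.

Lemma ideal_set0 : ideal ([set 0] : set R).
Proof. by split=> [//|x y -> ->|a x ->]; rewrite ?addr0 ?mulr0. Qed.

(* The ideal [I] makes the induction close: above [W], the condition that [f] be onto
   becomes the same condition for [V0 = W] and [I = f(W)]. *)
Definition onto_interval V0 V1 f I : set (set M) :=
  [set W | [/\ obj W, V0 `<` W, W `<` V1 & exists w, W w /\ I (f w - 1)]].

(** The values of [f] on a basis are unimodular modulo [I]. By SR3 they become unimodular after
    adding multiples of a single element [y] of [I], and the new values define [f']. *)
Lemma lift_functional n V0 V1 f I : subm V0 -> ext V0 V1 n.+2 -> ideal I ->
  linear_on V1 f -> (forall v, V0 v -> I (f v)) -> (exists v, V1 v /\ I (f v - 1)) ->
  exists f', [/\ linear_on V1 f', forall v, V0 v -> f' v = 0,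
    exists u, V1 u /\ f' u = 1 & forall v, V1 v -> I (f' v - f v)].
Proof.
move=> sV0 [b hb] iI lf fV0 [v [V1v Iv]]; have sV1 := ext_basis_subm sV0 hb.
have [I0 ID IM] := iI.
have V1b i : V1 (b i) by exact: ext_basis_in hb.
have [k [kl kV0 kb kW]] := ext_coord sV0 hb.
pose c i := k i v; pose x : 'cV[R]_n.+2 := \col_i f (b i).
(* The failure of the coordinates of [v] to witness unimodularity; it lies in [I] because [f v - 1]
   and the image of [V0] do. *)
pose y := 1 - \sum_i c i * x i 0.
have fE w : V1 w -> f w = f (w - lincomb b (fun i => k i w)) + \sum_i k i w * f (b i).
  move=> V1w; rewrite -(linear_on_comb _ sV1 lf) // -(linear_onD lf) ?subrK //.
    by apply: submB => //; exact: subm_comb.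
  exact: subm_comb.
have Iy : I y.
  have -> : y = f (v - lincomb b (fun i => k i v)) - (f v - 1).
    rewrite (fE v V1v) /y (eq_bigr (fun i => k i v * f (b i))); first by ring.
    by move=> i _; rewrite mxE.
  by apply: idealB => //; apply/fV0/kW.
have [|s [d hd]] := SR3_column sr (x0 := y) (x := x).
  exists 1, (\row_i c i); rewrite mul1r mxE.
  rewrite /y [X in _ + X](eq_bigr (fun i => c i * x i 0)) ?subrK // => i _.
  by rewrite [X in X * _]mxE.
pose f' w := \sum_i k i w * (x i 0 + y * s i 0).
have lf' : linear_on V1 f'.
  move=> a w1 w2 h1 h2; rewrite /f' mulr_sumr -big_split /=; apply: eq_bigr => i _.
  by rewrite kl //; ring.
exists f'; split=> //.
- by move=> w V0w; rewrite /f' big1 // => i _; rewrite kV0 // mul0r.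
- exists (lincomb b (fun i => d 0 i)); split; first exact: subm_comb.
  rewrite (linear_on_comb _ sV1 lf') //.
  have /matrixP/(_ 0 0) := hd; rewrite !mxE eqxx mulr1n => <-; apply: eq_bigr => i _.
  rewrite /f' (bigD1 i) //= big1 ?addr0 => [|j ji]; last first.
    by rewrite kb (negbTE ji) mul0r.
  by rewrite kb eqxx mul1r !mxE.
- move=> w V1w; rewrite fE //.
  have -> : f' w - (f (w - lincomb b (fun i => k i w)) + \sum_i k i w * f (b i)) =
     (\sum_i k i w * s i 0) * y - f (w - lincomb b (fun i => k i w)).
    have -> : f' w = \sum_i k i w * f (b i) + (\sum_i k i w * s i 0) * y.
      rewrite mulr_suml -big_split /=; apply: eq_bigr => i _; rewrite mxE; ring.
    by ring.
  by apply: idealB => //; [exact: IM|apply/fV0/kW].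
Qed.

(** [V1] splits as the line through [u] and the kernel of [f]; [g] is a coordinate of this kernel
    modulo [V0], extended by zero on [u]. *)
Lemma second_functional n V0 V1 f u : subm V0 -> ext V0 V1 n.+2 ->
  linear_on V1 f -> (forall v, V0 v -> f v = 0) -> V1 u -> f u = 1 ->
  exists g v, [/\ linear_on V1 g, forall v, V0 v -> g v = 0, g u = 0,
    V1 v /\ f v = 0 & g v = 1].
Proof.
move=> sV0 h01 lf fV0 V1u fu; have sV1 := ext_subm sV0 h01.
have [b hb] := ext_ker sr sV0 h01 lf fV0 V1u fu.
have [k [kl kV0 kb _]] := ext_coord sV0 hb.
have sK := subm_ker sV1 lf.
have KP w : V1 w -> (V1 `&` [set w | f w = 0]) (w - f w *: u).
  move=> V1w; split; first by apply: submB => //; exact: submZ.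
  rewrite /= (linear_onB sV1 lf) //; last exact: submZ.
  by rewrite (linear_onZ _ sV1 lf) // fu mulr1 subrr.
have [V1b fb] := ext_basis_in 0 sV0 hb.
exists (fun w => k 0 (w - f w *: u)), (b 0); split=> //.
- move=> a w1 w2 h1 h2; rewrite lf // -(kl 0 a) //; [|exact: KP|exact: KP].
  by congr (k 0 _); rewrite scalerBr scalerDl scalerA opprD addrACA.
- by move=> v V0v; rewrite fV0 // scale0r subr0 kV0.
- by rewrite fu scale1r subrr (linear_on0 sK (kl 0)).
- by rewrite fb scale0r subr0 kb eqxx.
Qed.

(** * The induction step for onto intervals *)

Section Step.
Variables (n : nat) (V0 V1 : set M).
Hypothesis IH : forall m, (m < n.+2)%N -> forall V0 V1 f I,
  obj V0 -> obj V1 -> ext V0 V1 m -> ideal I -> linear_on V1 f ->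
  (forall v, V0 v -> I (f v)) -> (exists v, V1 v /\ I (f v - 1)) ->
  conn cmp (m%:Z - 3) (onto_interval V0 V1 f I).
Hypothesis oV0 : obj V0.
Hypothesis oV1 : obj V1.
Hypothesis h01 : ext V0 V1 n.+2.

(** The ranks [r] below and [t] above [W] are both positive and add up to [n.+2], so both halves
    fall under the induction hypothesis and [(r-3) + (t-3) + 3] is the required bound. *)
Lemma split_interval f g I J W : linear_on V1 f -> linear_on V1 g ->
  obj W -> V0 `<` W -> W `<` V1 -> ideal I ->
  (forall v, V0 v -> I (f v)) -> (exists v, W v /\ I (f v - 1)) ->
  ideal J -> (forall v, W v -> J (g v)) -> (exists v, V1 v /\ J (g v - 1)) ->
  exists a b : int, [/\ a + b + 3 = n.+2%:Z - 3,
     conn cmp a (onto_interval V0 W f I) & conn cmp b (onto_interval W V1 g J)].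
Proof.
move=> lf lg oW V0W WV1 iI fV0 fW iJ gW gV1.
have [r [hr e0]] := obj_ext oV0 oW (proj1 V0W).
have [t [ht e1]] := obj_ext oW oV1 (proj1 WV1).
have rt : n.+2 = (r + t)%N.
  have e01 := ext_trans (proj1 oV0) e0 e1.
  exact: ext_uniq (proj1 oV0) h01 e01.
have := corank_lt oV0 oW V0W; have := corank_lt oW oV1 WV1 => c1 c0.
exists (r%:Z - 3), (t%:Z - 3); split; first by lia.
  by apply: IH => //; [lia|exact: linear_on_sub (proj1 WV1) lf].
by apply: IH => //; lia.
Qed.

Lemma onto_interval_surj f u : linear_on V1 f -> (forall v, V0 v -> f v = 0) ->
  V1 u -> f u = 1 -> conn cmp (n.+2%:Z - 3) (onto_interval V0 V1 f [set 0]).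
Proof.
move=> lf fV0 V1u fu; have sV1 := proj1 oV1.
have [g [v [lg gV0 gu [V1v fv] gv]]] := second_functional (proj1 oV0) h01 lf fV0 V1u fu.
pose X := onto_interval V0 V1 f [set 0].
pose K := V1 `&` [set w | g w = 0].
have XK (W : set M) w : obj W -> V0 `<=` W -> W `<` V1 -> W w -> f w = 1 -> X W.
  move=> oW V0W WV1 Ww fw; split=> //; last by exists w; rewrite /= fw subrr.
  split=> // /(_ w Ww)/fV0; rewrite fw => /eqP; by rewrite oner_eq0.
have XE W : X W -> exists w, W w /\ f w = 1.
  by move=> [_ _ _ [w [Ww /= /eqP]]]; rewrite subr_eq0 => /eqP fw; exists w.
(* If [W] contains [w] with [(f, g)] equal to [(0, 1)] and [w1] with [f w1 = 1], then
   [w1 - g w1 *: w] lies in [K] and still has [f]-value [1], so the intersection with [K] is again a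
   member. *)
have gWK W w : obj W -> V0 `<=` W -> W `<=` V1 -> W w -> g w = 1 -> f w = 0 ->
    (exists w, W w /\ f w = 1) -> X (W `&` K).
  move=> oW V0W WV1 Ww gw fw [w1 [Ww1 fw1]]; have sW := proj1 oW.
  have lgW := linear_on_sub WV1 lg; have lfW := linear_on_sub WV1 lf.
  have WK : W `&` K = W `&` [set w | g w = 0].
    by apply/seteqP; split=> z; [case=> ? []|case=> Wz gz; split=> //; split=> //; exact: WV1].
  have Wz : W (w1 - g w1 *: w) by apply: submB => //; exact: submZ.
  apply: (XK _ (w1 - g w1 *: w)).
  - rewrite WK; apply: obj_of_ext oW; first exact: subm_ker.
    exact: ext_ker1 Ww gw.
  - by move=> z V0z; split; [exact: V0W|split; [exact/WV1/V0W|exact: gV0]].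
  - split=> [z [_ []]//|/(_ v V1v)[_ [_ /=]]]; rewrite gv => /eqP.
    by rewrite oner_eq0.
  - split=> //; split; first exact: WV1.
    rewrite /= (linear_onB sW lgW) //; last exact: submZ.
    by rewrite (linear_onZ _ sW lgW) // gw mulr1 subrr.
  - rewrite (linear_onB sW lfW) //; last exact: submZ.
    by rewrite (linear_onZ _ sW lfW) // fw mulr0 subr0.
have XKK : X K.
  have -> : K = V1 `&` K by apply/seteqP; split=> z; [move=> Kz; split=> //; case: Kz|case].
  by apply: (gWK V1 v) => //; [exact: ext_sub h01|exists u].
pose A0 := [set W | X W /\ W `<=` K].
pose G := [set W | X W /\ (W `<=` K \/ exists w, [/\ W w, f w = 0 & g w = 1])].
have cA0 : conn cmp (n.+2%:Z - 3) A0.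
  by apply: (conn_cone _ (v := K)); [split|move=> U [_ UK]; right].
have Xobj W : X W -> obj W by case.
have cG : conn cmp (n.+2%:Z - 3) G.
  (* Here larger members come first. The neighbours of [W] then present are either above [W], or
     below [W] and inside [K]; all are comparable with the intersection of [W] and [K], which is an
     apex of the link. *)
  apply: (conn_attach_ranked (rho := corank) (b := (corank V0).+1) cA0).
  - by move=> W [XW WK]; split=> //; left.
  - by move=> W [[oW [V0W _] _ _] _] _; rewrite ltnS; exact: corank_le.
  - by move=> U W [/Xobj oU _] [/Xobj oW _] _ _; exact: cmp_corank_inj.
  move=> W [XW hW] nA0.
  have nWK : ~ W `<=` K by move=> WK; apply: nA0.
  have [w [Ww fw gw]] : exists w, [/\ W w, f w = 0 & g w = 1] by case: hW.
  have [oW [V0W _] [WV1 _] _] := XW.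
  have XWK := gWK W w oW V0W WV1 Ww gw fw (XE W XW).
  apply: (conn_cone _ (v := W `&` K)).
    split; [split=> //; left; exact: subIsetr|by right; exact: subIsetl|].
    by left; split=> //; exact: subIsetr.
  move=> U [[XU _] [WU|UW] h].
    by left; apply: subset_trans WU; exact: subIsetl.
  case: h => [[_ UK]|h]; first by right; move=> z Uz; split; [exact: UW|exact: UK].
  by have := corank_le (Xobj U XU) oW UW; move: h; lia.
apply: (conn_attach_objs oV0 _ _ cG).
- by move=> W [oW [V0W _] _ _].
- by move=> W [].
move=> W XW nGW; have [oW V0W WV1 _] := XW; have [w0 [Ww0 fw0]] := XE W XW.
have sW := proj1 oW; have WV1' := proj1 WV1.
(* As [f w0 = 1], this [h] vanishes at [w0]. For [U] above [W], [(f, g)] is onto on [U] exactly when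
   [h] is: if [h z = 1], then [z - f z *: w0] has values [(0, 1)]. Since [h] maps [W] into the image
   of [U], this is the same as being onto modulo [h(W)]. *)
pose h z := g z - g w0 * f z.
have lh : linear_on V1 h.
  by move=> a z1 z2 hz1 hz2; rewrite /h lf // lg //; ring.
have lhW := linear_on_sub WV1' lh.
have [||||a [b [ab ca cb]]] := @split_interval f h [set 0] [set h w | w in W] W lf lh oW V0W WV1 ideal_set0 fV0.
- by exists w0; rewrite /= fw0 subrr.
- exact: ideal_image.
- by move=> z Wz; exists z.
- exists v; split=> //; rewrite /h fv gv mulr0 subr0 subrr.
  by exists 0; [exact: subm0|exact: linear_on0 lhW].
exists a, b; split=> //.
  move: ca; congr (conn _ _); apply/seteqP; split=> U /=.
    move=> [oU V0U UW hU]; split=> //; split=> //.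
    split; first by apply: subset_trans WV1'; case: UW.
    by move=> V1U; case: WV1 => _; apply; apply: subset_trans V1U _; case: UW.
  by move=> [[oU V0U UV1 hU] UW].
move: cb; congr (conn _ _); apply/seteqP; split=> U /=.
  move=> [oU WU UV1 [z [Uz [z2 Wz2 hz]]]].
  have UV1' := proj1 UV1; have WU' := proj1 WU; have sU := proj1 oU.
  have lhU := linear_on_sub UV1' lh; have lfU := linear_on_sub UV1' lf.
  have lgU := linear_on_sub UV1' lg.
  split=> //; split; first by apply: (XK U w0) => //; [apply: subset_trans WU'; case: V0W|exact: WU'].
  right; pose z3 := z - z2; have Uz3 : U z3 by apply: submB => //; exact: WU'.
  have hz3 : h z3 = 1 by rewrite (linear_onB sU lhU) // ?hz; [ring|exact: WU'].
  have Uw0 : U (f z3 *: w0) by apply: submZ => //; exact: WU'.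
  exists (z3 - f z3 *: w0); split; first exact: submB.
    rewrite (linear_onB sU lfU) // (linear_onZ _ sU lfU) ?fw0 ?mulr1 ?subrr //; exact: WU'.
  rewrite (linear_onB sU lgU) // (linear_onZ _ sU lgU); last exact: WU'.
  by rewrite -hz3 /h; ring.
move=> [[XU hU] WU]; have [oU V0U UV1 _] := XU; split=> //.
case: hU => [UK|[z [Uz fz gz]]].
  by case: nGW; split=> //; left; apply: subset_trans UK; case: WU.
exists z; split=> //; rewrite /h fz gz mulr0 subr0 subrr.
by exists 0; [exact: subm0|exact: linear_on0 lhW].
Qed.

Lemma onto_interval_step f I : ideal I -> linear_on V1 f ->
  (forall v, V0 v -> I (f v)) -> (exists v, V1 v /\ I (f v - 1)) ->
  conn cmp (n.+2%:Z - 3) (onto_interval V0 V1 f I).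
Proof.
move=> iI lf fV0 fV1.
have [f' [lf' f'V0 [u [V1u fu]] ff']] := lift_functional (proj1 oV0) h01 iI lf fV0 fV1.
have [I0 ID IM] := iI.
have -> : onto_interval V0 V1 f I = onto_interval V0 V1 f' I.
  apply/seteqP; split=> W [oW V0W WV1 [w [Ww Iw]]]; split=> //; exists w; split=> //.
    have h := ff' w ((proj1 WV1) w Ww).
    by rewrite (_ : f' w - 1 = (f w - 1) + (f' w - f w)); [exact: ID|ring].
  have h := ff' w ((proj1 WV1) w Ww).
  by rewrite (_ : f w - 1 = (f' w - 1) - (f' w - f w)); [exact: idealB|ring].
have cX0 := onto_interval_surj lf' f'V0 V1u fu.
apply: (conn_attach_objs oV0 _ _ cX0).
- by move=> W [oW [V0W _] _ _].
- by move=> W [oW V0W WV1 [w [Ww /= hw]]]; split=> //; exists w; rewrite hw.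
move=> W [oW V0W WV1 [w [Ww Iw]]] nX0; have sW := proj1 oW; have WV1' := proj1 WV1.
have lfW := linear_on_sub WV1' lf'.
(* Above [W] only members with [f'(U) = R] are present. As [f'(W)] lies in [f'(U)], this means being
   onto modulo [f'(W)], an ideal that contains the image of the new lower end [W]. *)
have [|||||a [b [ab ca cb]]] := @split_interval f' f' I [set f' w | w in W] W lf' lf' oW V0W WV1 iI.
- by move=> z /f'V0 ->.
- by exists w.
- exact: ideal_image.
- by move=> z Wz; exists z.
- exists u; split=> //; rewrite fu subrr.
  by exists 0; [exact: subm0|exact: linear_on0 lfW].
exists a, b; split=> //.
  move: ca; congr (conn _ _); apply/seteqP; split=> U /=.
    move=> [oU V0U UW hU]; split=> //; split=> //.
    split; first by apply: subset_trans WV1'; case: UW.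
    by move=> V1U; case: WV1 => _; apply; apply: subset_trans V1U _; case: UW.
  by move=> [[oU V0U UV1 hU] UW].
move: cb; congr (conn _ _); apply/seteqP; split=> U /=.
  move=> [oU WU UV1 [z [Uz [z2 Wz2 hz]]]].
  have UV1' := proj1 UV1; have WU' := proj1 WU; have sU := proj1 oU.
  have lfU := linear_on_sub UV1' lf'.
  split=> //; split=> //.
    split; first by apply: subset_trans WU'; case: V0W.
    by move=> UV0; case: WU => _; apply; apply: subset_trans UV0 _; case: V0W.
  exists (z - z2); split; first by apply: submB => //; exact: WU'.
  by rewrite /= (linear_onB sU lfU) // ?hz; [ring|exact: WU'].
move=> [[oU V0U UV1 [z [Uz /= hz]]] WU]; split=> //; exists z; split=> //.
rewrite hz; by exists 0; [exact: subm0|exact: linear_on0 lfW].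
Qed.
End Step.

Theorem onto_interval_conn m V0 V1 f I :
  obj V0 -> obj V1 -> ext V0 V1 m -> ideal I -> linear_on V1 f ->
  (forall v, V0 v -> I (f v)) -> (exists v, V1 v /\ I (f v - 1)) ->
  conn cmp (m%:Z - 3) (onto_interval V0 V1 f I).
Proof.
elim/ltn_ind: m V0 V1 f I => -[|[|m]] IH V0 V1 f I oV0 oV1 h01 iI lf fV0 fV1.
- by apply: conn_void; lia.
- by apply: conn_void; lia.
- exact: onto_interval_step IH oV0 oV1 h01 f I iI lf fV0 fV1.
Qed.

Definition interval V0 V1 : set (set M) :=
  [set W | [/\ obj W, V0 `<` W & W `<` V1]].

Lemma interval_conn m V0 V1 : obj V0 -> obj V1 -> ext V0 V1 m ->
  conn cmp (m%:Z - 3) (interval V0 V1).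
Proof.
move=> oV0 oV1 h01.
have -> : interval V0 V1 = onto_interval V0 V1 (fun=> 0) setT.
  apply/seteqP; split=> W; last by case.
  by move=> [oW V0W WV1]; split=> //; exists 0; split=> //; exact: subm0 (proj1 oW).
apply: onto_interval_conn => //.
- by move=> a u v _ _; rewrite mulr0 addr0.
- by exists 0; split=> //; exact: subm0 (proj1 oV1).
Qed.

End Intervals.

(** * The Tits complex *)

Section FiniteCard.
Variable T : choiceType.
Implicit Types A B : set T.

Definition ncard A : nat := #|` fset_set A|.

Lemma ncardP A : finite_set A -> (A #= `I_(ncard A))%card.
Proof. by move=> fA; rewrite -{1}(fset_setK fA); apply/card_eq_fsetP. Qed.

Lemma ncardE A k : (A #= `I_k)%card -> finite_set A /\ ncard A = k.
Proof.
move=> h; split; last exact: card_fset_set.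
by exists k.
Qed.

Lemma ncardU A B : finite_set A -> finite_set B -> A `&` B = set0 ->
  ncard (A `|` B) = (ncard A + ncard B)%N.
Proof.
move=> fA fB AB; rewrite /ncard fset_setU // cardfsU -fset_setI // AB fset_set0.
by rewrite cardfs0 subn0.
Qed.

Lemma ncard_le A B : finite_set B -> A `<=` B -> (ncard A <= ncard B)%N.
Proof.
move=> fB AB; apply: fsubset_leq_card; rewrite -fset_set_sub //.
exact: sub_finite_set fB.
Qed.

Lemma ncard0 : ncard set0 = 0%N.
Proof. by rewrite /ncard fset_set0 cardfs0. Qed.

Lemma ncard1 x : ncard [set x] = 1%N.
Proof. by rewrite /ncard fset_set1 cardfs1. Qed.

Lemma ncard_range n (F : 'I_n -> T) : injective F -> ncard (range F) = n.
Proof.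
move=> Fi; apply: card_fset_set.
apply: card_eq_trans (inj_card_eq _) _; first by move=> x y _ _; exact: Fi.
by rewrite card_eq_sym card_II.
Qed.

End FiniteCard.

(** * Chains, their links and their refinement to flags *)

Section Flags.
Variables (R : comNzRingType) (M : lmodType R).
Hypothesis sr : SR3 R.
Implicit Types (V W U : set M) (S : set (set M)).

Lemma sub_interval V0 V1 W : obj V0 -> obj V1 -> interval V0 V1 W ->
  exists r t, [/\ (0 < r)%N, (0 < t)%N, ext V0 W r & ext W V1 t].
Proof.
move=> oV0 oV1 [oW V0W WV1].
have [r [hr e0]] := obj_ext sr oV0 oW (proj1 V0W).
have [t [ht e1]] := obj_ext sr oW oV1 (proj1 WV1).
have := corank_lt sr oV0 oW V0W; have := corank_lt sr oW oV1 WV1 => c1 c0.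
by exists r, t; split=> //; lia.
Qed.

Definition chain S := forall U W, S U -> S W -> cmp U W.

Lemma proper_cmp U W : cmp U W -> U <> W -> U `<` W \/ W `<` U.
Proof.
move=> [UW|WU] h; [left|right]; split=> // h'; apply: h; exact/seteqP.
Qed.

(** Cutting at a member [W] of [S], the link becomes the join of two links in the intervals below
    and above [W]. The numbers of remaining members satisfy [p = p1 + p2 + 1], so
    [(r-3-p1) + (t-3-p2) + 2 = m-3-p]. *)
Lemma chain_link_conn p m V0 V1 S : obj V0 -> obj V1 -> ext V0 V1 m ->
  finite_set S -> ncard S = p -> S `<=` interval V0 V1 -> chain S ->
  conn (@cmp R M) (m%:Z - 3 - p%:Z)
    [set U | [/\ interval V0 V1 U, ~ S U & forall W, S W -> cmp U W]].
Proof.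
elim/ltn_ind: p m V0 V1 S => p IH m V0 V1 S oV0 oV1 h01 fS Sp SI Sc.
have [S0|/set0P[W SW]] := eqVneq S set0.
  rewrite (_ : [set U | _] = interval V0 V1).
    by rewrite -Sp S0 ncard0 subr0; exact: interval_conn.
  apply/seteqP; split=> U; first by case.
  by move=> IU; split=> //; rewrite S0.
have WI := SI W SW; have [oW V0W WV1] := WI.
have [r [t [r0 t0 e0 e1]]] := sub_interval oV0 oV1 WI.
have mrt : m = (r + t)%N by exact: ext_uniq (proj1 oV0) h01 (ext_trans (proj1 oV0) e0 e1).
pose S1 := [set U | S U /\ U `<` W]; pose S2 := [set U | S U /\ W `<` U].
have fS1 : finite_set S1 by apply: sub_finite_set fS => U [].
have fS2 : finite_set S2 by apply: sub_finite_set fS => U [].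
have SE : S = (S1 `|` [set W]) `|` S2.
  apply/seteqP; split=> U; last by case=> [[[]|->]|[]].
  move=> SU; have [->|UW] := pselect (U = W); first by left; right.
  by have [h|h] := proper_cmp (Sc U W SU SW) UW; [left; left|right].
have pE : p = (ncard S1 + ncard S2).+1.
  rewrite -Sp [in LHS]SE !ncardU ?ncard1; first by lia.
  - by [].
  - exact: finite_set1.
  - by apply/seteqP; split=> // U [[_ [_ h]] UW]; apply: h; rewrite UW.
  - by rewrite finite_setU; split=> //; exact: finite_set1.
  - by [].
  - apply/seteqP; split=> // U [[[_ UW]|UW] [_ WU]].
      by case: UW => _; apply; case: WU.
    by case: WU => _; apply; rewrite UW.
have IH1 := IH (ncard S1) ltac:(lia) r V0 W S1 oV0 oW e0 fS1 erefl.
have IH2 := IH (ncard S2) ltac:(lia) t W V1 S2 oW oV1 e1 fS2 erefl.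
have {}IH1 : conn (@cmp R M) (r%:Z - 3 - (ncard S1)%:Z)
    [set U | [/\ interval V0 W U, ~ S1 U & forall W', S1 W' -> cmp U W']].
  apply: IH1; first by move=> U [/SI[oU V0U _] UW].
  by move=> U U' [SU _] [SU' _]; exact: Sc.
have {}IH2 : conn (@cmp R M) (t%:Z - 3 - (ncard S2)%:Z)
    [set U | [/\ interval W V1 U, ~ S2 U & forall W', S2 W' -> cmp U W']].
  apply: IH2; first by move=> U [/SI[oU _ UV1] WU].
  by move=> U U' [SU _] [SU' _]; exact: Sc.
have := conn_join_below sr _ _ oW _ IH1 IH2.
have -> : r%:Z - 3 - (ncard S1)%:Z + (t%:Z - 3 - (ncard S2)%:Z) + 2 = m%:Z - 3 - p%:Z.
  by lia.
have ltp (A B C : set M) : A `<` B -> B `<=` C -> A `<` C.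
  move=> [AB nBA] BC; split; first exact: subset_trans AB BC.
  by move=> CA; apply: nBA; exact: subset_trans BC CA.
have ltp' (A B C : set M) : A `<=` B -> B `<` C -> A `<` C.
  move=> AB [BC nCB]; split; first exact: subset_trans AB BC.
  by move=> CA; apply: nCB; exact: subset_trans CA AB.
set L1 := [set U | _]; set L2 := [set U | _] => h.
have -> : [set U | [/\ interval V0 V1 U, ~ S U & forall W', S W' -> cmp U W']] = L1 `|` L2.
  apply/seteqP; split=> U.
    move=> [[oU V0U UV1] nSU hU].
    have UW : U <> W by move=> e; apply: nSU; rewrite e.
    have [hUW|hUW] := proper_cmp (hU W SW) UW; [left|right].
      split=> //; first by move=> [].
      by move=> W' [SW' _]; exact: hU.
    split=> //; first by move=> [].
    by move=> W' [SW' _]; exact: hU.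
  move=> [[[oU V0U UW] nSU hU]|[[oU WU UV1] nSU hU]].
    split; first by split=> //; apply: ltp UW (proj1 WV1).
      by move=> SU; apply: nSU.
    move=> W'; rewrite {1}SE => -[[SW'|->]|[_ WW']]; [exact: hU|by left; case: UW|].
    by left; apply: subset_trans (proj1 WW'); case: UW.
  split; first by split=> //; apply: ltp' WU; case: V0W.
    by move=> SU; apply: nSU.
  move=> W'; rewrite {1}SE => -[[[_ WW']|->]|SW']; [|by right; case: WU|exact: hU].
  by right; apply: subset_trans (proj1 WU); case: WW'.
apply: h.
- by move=> U [[]].
- by move=> U [[]].
- exists (corank V0).+1 => U [[oU V0U _] _ _]; rewrite ltnS.
  exact: (corank_le sr oV0 oU (proj1 V0U)).
Qed.

(** The interval is cut at a member comparable with all of [S], and the flags obtained on both sides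
    are glued there. Recording the exact rank between any two steps makes all quotients free. *)
Lemma complete_chain m V0 V1 S : obj V0 -> obj V1 -> ext V0 V1 m ->
  S `<=` interval V0 V1 -> chain S ->
  exists F : nat -> set M, [/\ F 0%N = V0, F m = V1,
    forall i j, (i <= j)%N -> (j <= m)%N -> ext (F i) (F j) (j - i) &
    forall U, S U -> exists i, [/\ (0 < i)%N, (i < m)%N & F i = U]].
Proof.
elim/ltn_ind: m V0 V1 S => m IH V0 V1 S oV0 oV1 h01 SI Sc.
have small W : interval V0 V1 W -> (1 < m)%N.
  move=> /(sub_interval oV0 oV1)[r [t [r0 t0 e0 e1]]].
  by rewrite (ext_uniq (proj1 oV0) h01 (ext_trans (proj1 oV0) e0 e1)); lia.
have [m1|m1] := leqP m 1.
  exists (fun i => if i == 0%N then V0 else V1); split=> //.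
  - by case: m m1 h01 {IH small} => [|m] // _ /ext0_eq.
  - move=> i j; case: i => [|i]; case: j => [|j] //= _ jm.
    + exact: ext_refl.
    + by move: h01; rewrite (_ : m = j.+1 - 0)%N //; lia.
    + by rewrite (_ : j.+1 - i.+1 = 0)%N; [exact: ext_refl|lia].
  - by move=> U /SI/small; lia.
have [W [WI hW]] : exists W, interval V0 V1 W /\ forall U, S U -> cmp U W.
  have [S0|/set0P[W SW]] := eqVneq S set0; last first.
    by exists W; split=> [|U SU]; [exact: SI|exact: Sc].
  case: m h01 m1 {IH small} => [//|[//|m]] h01 _.
  (* With [S] empty any intermediate member will do, here the kernel of a coordinate functional. *)
  have [b hb] := h01; have [k [kl kV kb _]] := ext_coord (proj1 oV0) hb.
  have V1b : V1 (b 0) by exact: ext_basis_in (proj1 oV0) hb.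
  have kb0 : k 0 (b 0) = 1 by rewrite kb eqxx.
  have e0 := ext_ker sr (proj1 oV0) h01 (kl 0) (kV 0) V1b kb0.
  have sW := subm_ker (proj1 oV1) (kl 0).
  have oW := obj_of_ext sW (ext_ker1 (proj1 oV1) (kl 0) V1b kb0) oV1.
  exists (V1 `&` [set w | k 0 w = 0]); split; last by rewrite S0.
  split=> //; split.
  - exact: ext_sub e0.
  - move=> h; have e := ext_uniq (proj1 oV0) e0; have := e 0%N.
    by rewrite (_ : V1 `&` _ = V0) => [/(_ (ext_refl _))//|]; apply/seteqP; split=> //; exact: ext_sub e0.
  - by move=> z [].
  - by move=> /(_ _ V1b)[_ /=]; rewrite kb0 => /eqP; rewrite oner_eq0.
have [oW V0W WV1] := WI.
have [r [t [r0 t0 e0 e1]]] := sub_interval oV0 oV1 WI.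
have mrt : m = (r + t)%N by exact: ext_uniq (proj1 oV0) h01 (ext_trans (proj1 oV0) e0 e1).
have [||F1 [F10 F1r F1e F1S]] := IH r ltac:(lia) V0 W [set U | S U /\ U `<` W] oV0 oW e0.
- by move=> U [/SI[oU V0U _] UW].
- by move=> U U' [SU _] [SU' _]; exact: Sc.
have [||F2 [F20 F2t F2e F2S]] := IH t ltac:(lia) W V1 [set U | S U /\ W `<` U] oW oV1 e1.
- by move=> U [/SI[oU _ UV1] WU].
- by move=> U U' [SU _] [SU' _]; exact: Sc.
pose F i := if (i <= r)%N then F1 i else F2 (i - r)%N.
have sF1 i : (i <= r)%N -> subm (F1 i).
  move=> ir; apply: (ext_subm (proj1 oV0)); rewrite -F10; exact: F1e.
have FV0 : F 0%N = V0 by rewrite /F leq0n.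
have Fge i : (r <= i)%N -> F i = F2 (i - r)%N.
  rewrite /F leq_eqVlt => /orP[/eqP<-|ri]; first by rewrite leqnn subnn F1r F20.
  by rewrite leqNgt ri.
exists F; split=> //.
- by rewrite Fge; [rewrite mrt addKn F2t|lia].
- move=> i j ij jm; have [jr|rj] := leqP j r.
    by rewrite /F jr (leq_trans ij jr); exact: F1e.
  rewrite (Fge j (ltnW rj)); have [ir|ri] := leqP i r.
    rewrite /F ir (_ : j - i = (r - i) + (j - r))%N; last by lia.
    apply: (ext_trans (W := W) (sF1 i ir)); first by rewrite -F1r; exact: F1e.
    by rewrite -F20 -[X in ext _ _ X]subn0; apply: F2e; lia.
  rewrite (Fge i (ltnW ri)) (_ : j - i = (j - r) - (i - r))%N; last by lia.
  by apply: F2e; lia.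
- move=> U SU; have [->|UW] := pselect (U = W).
    by exists r; split=> //; [lia|rewrite /F leqnn].
  have [h|h] := proper_cmp (hW U SU) UW.
    have [i [i0 ir Fi]] := F1S U (conj SU h).
    by exists i; split=> //; [lia|rewrite /F ltnW].
  have [i [i0 ir Fi]] := F2S U (conj SU h).
  by exists (i + r)%N; split; [lia|lia|rewrite Fge ?addnK //; lia].
Qed.

End Flags.

(** * Flags in [R^n] and the Tits complex *)

Section Tits.
Variables (R : comNzRingType) (n : nat).
Hypothesis sr : SR3 R.
Local Notation M := 'rV[R]_n.
Implicit Types (V W U : set M) (S : set (set M)).

Let O : set M := [set 0].

Lemma subm_set0 : subm O.
Proof. by split=> [//|u v -> ->|a v ->]; rewrite /O /= ?addr0 ?scaler0. Qed.

Lemma free_rank_ext V r : free_rank V r <-> ext O V r.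
Proof.
split=> -[b [hb bi]]; exists b; split.
- move=> w; rewrite hb; split.
    by move=> [c ->]; exists 0, c; rewrite add0r.
  by move=> [v [c [-> ->]]]; exists c; rewrite add0r.
- by move=> c; exact: bi.
- move=> v; rewrite hb; split.
    by move=> [v0 [c [-> ->]]]; exists c; rewrite add0r.
  by move=> [c ->]; exists 0, c; rewrite add0r.
- by move=> c h; apply: bi.
Qed.

Lemma ext_full : ext O setT n.
Proof.
apply/free_rank_ext; exists (fun i => delta_mx 0 i); split.
  by move=> v; split=> // _; exists (fun i => v 0 i); exact: row_sum_delta.
move=> c h i; have : (\row_j c j) 0 i = 0 by rewrite [\row_j c j]row_sum_delta; under eq_bigr do rewrite mxE; rewrite h mxE.
by rewrite mxE.
Qed.

Lemma obj_full : obj (setT : set M).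
Proof. by split=> //; exists 0%N; exact: ext_refl. Qed.

Lemma obj_set0 : obj O.
Proof. by split; [exact: subm_set0|exists n; exact: ext_full]. Qed.

Lemma complement_ext V W r : complement V W -> free_rank W r -> ext V setT r.
Proof.
move=> [sV sW VW VWT] [b [hb bi]]; exists b; split.
  move=> w; split=> // _; have [u [v [Vu /hb[c ->] ->]]] := VWT w.
  by exists u, c.
move=> c Vc; apply: bi; apply: VW => //.
by apply/hb; exists c.
Qed.

Lemma ext_complement V r : subm V -> ext V setT r ->
  exists W, complement V W /\ free_rank W r.
Proof.
move=> sV [b hb]; exists [set w | exists c, w = lincomb b c]; split; last first.
  exists b; split=> // c h; apply: (proj2 hb); rewrite /lincomb h; exact: subm0.
split=> //.
- split.
  + by exists (fun=> 0); rewrite /lincomb big1 // => i _; rewrite scale0r.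
  + by move=> u v [c ->] [c' ->]; exists (fun i => c i + c' i); rewrite lincombD.
  + by move=> a v [c ->]; exists (fun i => a * c i); rewrite lincombZ.
- move=> x Vx [c xE]; rewrite xE in Vx *.
  by rewrite /lincomb big1 // => i _; rewrite ((proj2 hb) c Vx) scale0r.
- move=> x; have [v [c [Vv ->]]] := proj1 (proj1 hb x) I.
  by exists v, (lincomb b c); split=> //; exists c.
Qed.

Lemma set0_proper V : subm V -> V <> O -> O `<` V.
Proof.
move=> sV h; split=> [x ->|VO]; first exact: subm0.
by apply: h; apply/seteqP; split=> // x ->; exact: subm0.
Qed.

Lemma proper_full V : V <> setT -> V `<` setT.
Proof. by move=> h; split=> // TV; apply: h; apply/seteqP. Qed.

Lemma tits_vertexE V : tits_vertex V <-> interval O setT V.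
Proof.
split.
  move=> [V0 VT _ [W [cVW [r fW]]]]; have sV : subm V by case: cVW.
  split; [|exact: set0_proper|exact: proper_full].
  by split=> //; exists r; exact: complement_ext fW.
move=> [oV V0 VT]; have [sV [s hs]] := oV; split.
- by move=> h; case: V0; rewrite h.
- by move=> h; case: VT; rewrite h.
- have [r [_ e0]] := obj_ext sr obj_set0 oV (proj1 V0).
  by exists r; apply/free_rank_ext.
- have [W [cVW fW]] := ext_complement sV hs.
  by exists W; split=> //; exists s.
Qed.

Lemma complement_sym V W : complement V W -> complement W V.
Proof.
move=> [sV sW VW VWT]; split=> // [x Wx Vx|x]; first exact: VW.
by have [u [v [Vu Wv ->]]] := VWT x; exists v, u; rewrite addrC.
Qed.

(** A complement [W] of a free [V] is stably free, hence free by cancellation, and [W] is a copy of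
    the quotient by [V]. *)
Lemma free_summand_obj V : Defs.free V -> direct_summand V -> obj V.
Proof.
move=> [r fV] [W cVW]; have [sV sW _ _] := cVW; split=> //.
have eW := complement_ext (complement_sym cVW) fV.
have OW : O `<=` W by move=> x ->; exact: subm0.
have [t [_ e0]] := ext_cancel sr subm_set0 sW OW ext_full eW.
by exists t; apply: (complement_ext cVW); apply/free_rank_ext.
Qed.

Lemma complete_flag_interval (F : 'I_n.-1 -> set M) i :
  complete_flag F -> interval O setT (F i).
Proof.
move=> [h1 h2 _]; have [fF sF] := h1 i; have [F0 FT] := h2 i.
have oF := free_summand_obj fF sF.
by split=> //; [apply: set0_proper => //; case: oF|exact: proper_full].
Qed.

Lemma complete_flag_chain (F : 'I_n.-1 -> set M) : complete_flag F -> chain (range F).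
Proof.
move=> [_ _ h] _ _ [i _ <-] [j _ <-].
case: (ltngtP i j) => [ij|ji|/val_inj->]; last by left.
  by left; case: (h i j ij).
by right; case: (h j i ji).
Qed.

Lemma complete_flag_inj (F : 'I_n.-1 -> set M) : complete_flag F -> injective F.
Proof.
move=> [_ _ h] i j Fij; apply/val_inj; case: (ltngtP i j) => // [ij|ji].
  by have := h i j ij; rewrite Fij => -[_ []].
by have := h j i ji; rewrite Fij => -[_ []].
Qed.

Lemma chain_complete_flag S : S `<=` interval O setT -> chain S ->
  exists F, @complete_flag R n F /\ S `<=` range F.
Proof.
move=> SI Sc.
have [F [F0 Fn Fe FS]] := complete_chain sr obj_set0 obj_full ext_full SI Sc.
have lt i : (i < n.-1)%N -> (i.+1 < n)%N by lia.
have sF i : (i <= n)%N -> subm (F i).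
  by move=> hi; apply: (ext_subm subm_set0); rewrite -F0; exact: Fe.
have Fpr i j : (i < j)%N -> (j <= n)%N -> F i `<` F j.
  move=> ij jn; have e := Fe i j (ltnW ij) jn; split; first exact: ext_sub e.
  move=> h; have FE : F i = F j by apply/seteqP; split=> //; exact: ext_sub e.
  have := ext_uniq (sF i ltac:(lia)) e; rewrite FE => /(_ 0%N (ext_refl _)); lia.
exists (fun i : 'I_n.-1 => F i.+1); split; last first.
  move=> U /FS[i [i0 im <-]]; have hi : (i.-1 < n.-1)%N by lia.
  by exists (Ordinal hi) => //=; rewrite prednK.
split.
- move=> i; have hi := lt i (ltn_ord i); split.
    by exists i.+1; apply/free_rank_ext; rewrite -F0 -[X in ext _ _ X]subn0; apply: Fe; lia.
  have e : ext (F i.+1) setT (n - i.+1) by rewrite -Fn; apply: Fe; lia.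
  by have [W [cVW _]] := ext_complement (sF _ (ltnW hi)) e; exists W.
- move=> i; have hi := lt i (ltn_ord i); split=> h.
    by have [_ nh] := Fpr 0%N i.+1 isT (ltnW hi); apply: nh; rewrite h F0.
  by have [_ nh] := Fpr i.+1 n hi (leqnn n); apply: nh; rewrite h Fn.
- by move=> i j ij; apply: Fpr; [lia|have := lt j (ltn_ord j); lia].
Qed.

(** Every chain of vertices refines to a complete flag, so goodness of a flag reduces to pairwise
    comparability. *)
Lemma tits_complexE :
  tits_complex R n = flag_complex (@cmp R M) (interval O setT).
Proof.
apply/seteqP; split=> s.
  move=> [s0 fs sv [F [cF sF]]]; split=> //; first by move=> V /sv/tits_vertexE.
  by move=> U W /sF hU /sF hW; exact: (complete_flag_chain cF).
move=> [s0 fs sI sc]; split=> //; first by move=> V /sI/tits_vertexE.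
exact: chain_complete_flag.
Qed.

Lemma max_flag S : S `<=` interval O setT -> chain S ->
  exists P, [/\ S `<=` P, P `<=` interval O setT, chain P, finite_set P & ncard P = n.-1].
Proof.
move=> SI Sc; have [F [cF SF]] := chain_complete_flag SI Sc.
exists (range F); split=> //.
- by move=> _ [i _ <-]; exact: complete_flag_interval.
- exact: complete_flag_chain.
- by apply: finite_image; exact: finite_finset.
- by apply: ncard_range; exact: complete_flag_inj.
Qed.

Lemma link_flag_complex S : S `<=` interval O setT -> finite_set S -> chain S ->
  link (tits_complex R n) S = flag_complex (@cmp R M)
    [set U | [/\ interval O setT U, ~ S U & forall W, S W -> cmp U W]].
Proof.
move=> SI fS Sc; rewrite tits_complexE; apply/seteqP; split=> s.
  move=> [[s0 fs sI sc] sS [_ _ _ sSc]]; split=> // U sU; split; first exact: sI.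
    by move=> SU; have : (s `&` S) U by []; rewrite sS.
  by move=> W SW; apply: sSc; [left|right].
move=> [s0 fs sI sc]; split.
- by split=> // U /sI[].
- by apply/seteqP; split=> // U [/sI[_ nSU _]].
- split.
  + by have [x sx] := s0; exists x; left.
  + by rewrite finite_setU.
  + by move=> U [/sI[]//|/SI].
  + move=> U W [sU|SU] [sW|SW].
    * exact: sc.
    * by have [_ _] := sI U sU; exact.
    * by have [_ _ h] := sI W sW; apply/cmp_sym/h.
    * exact: Sc.
Qed.

(** With [S] empty this covers the complex itself. For the dimension, a simplex of the link together
    with [S] extends to a complete flag, which has [n-1] members, and removing [S] from such a flag
    attains the bound. *)
Lemma tits_link_spherical S p : (0 < n)%N ->
  S `<=` interval O setT -> finite_set S -> chain S ->
  ncard S = p -> spherical (flag_complex (@cmp R M)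
    [set U | [/\ interval O setT U, ~ S U & forall W, S W -> cmp U W]])
    (n%:Z - 2 - p%:Z).
Proof.
move=> n0 SI fS Sc Sp; split; last first.
  have -> : n%:Z - 2 - p%:Z - 1 = n%:Z - 3 - p%:Z by lia.
  apply: conn_connected_upto; [exact: cmp_sym|exact: cmp_refl|].
  exact: (chain_link_conn sr obj_set0 obj_full ext_full fS Sp SI Sc).
split.
  move=> s [s0 fs sI sc]; exists (ncard s); split; first exact: ncardP.
  have [||P [sP PI Pc fP Pn]] := @max_flag (s `|` S).
  - by move=> U [/sI[]|/SI].
  - move=> U W [sU|SU] [sW|SW].
    + exact: sc.
    + by have [_ _] := sI U sU; exact.
    + by have [_ _ h] := sI W sW; apply/cmp_sym/h.
    + exact: Sc.
  have := ncard_le fP sP; rewrite ncardU //; last first.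
    by apply/seteqP; split=> // U [/sI[_ nSU _]].
  by rewrite Pn Sp; move: (ncard s) => q h; lia.
have [P [SP PI Pc fP Pn]] := max_flag SI Sc.
pose s := P `\` S; have fs : finite_set s by apply: sub_finite_set fP => U [].
have Ps : P = s `|` S.
  apply/seteqP; split=> U; last by case=> [[]|/SP].
  by move=> PU; have [SU|SU] := pselect (S U); [right|left].
have : ncard P = (ncard s + ncard S)%N.
  by rewrite [in LHS]Ps ncardU //; apply/seteqP; split=> // U [[]].
rewrite Pn Sp => nE.
(* If [S] is itself a complete flag, its link is empty and the dimension is [-1]. *)
have [s0|/set0P s0] := eqVneq s set0.
  by left; move: nE; rewrite s0 ncard0; lia.
right; exists s; split; last by exists (ncard s); split; [exact: ncardP|lia].
split=> //; last by move=> U W [PU _] [PW _]; exact: Pc.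
by move=> U [PU nSU]; split; [exact: PI| |move=> W /SP PW; exact: Pc].
Qed.

Lemma tits_cohen_macaulay : (0 < n)%N ->
  cohen_macaulay (tits_complex R n) (n%:Z - 2).
Proof.
move=> n0; split.
  have := @tits_link_spherical set0 0 n0; rewrite subr0 tits_complexE.
  rewrite (_ : [set U | _] = interval O setT).
    by apply=> //; exact: ncard0.
  by apply/seteqP; split=> U; [case|move=> IU; split].
move=> k S; rewrite {1}tits_complexE => -[_ fS SI Sc] /ncardE[_ Sk].
rewrite link_flag_complex // (_ : _ - 1 = n%:Z - 2 - k.+1%:Z); last by lia.
exact: tits_link_spherical.
Qed.
End Tits.

Theorem theoremA (R : comNzRingType) (n : nat) :
  (SR2 R \/ arithmetic_dedekind R) -> (2 <= n)%N ->
  cohen_macaulay (tits_complex R n) (n%:Z - 2) /\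
  connected_upto (tits_complex R n) (n%:Z - 3).
Proof.
move=> hR n2; have sr : SR3 R by case: hR => [/SR2_SR3|/arithmetic_SR3].
have CM := tits_cohen_macaulay sr (ltnW n2); split=> //.
have [[_ h] _] := CM; rewrite (_ : n%:Z - 3 = n%:Z - 2 - 1) //; lia.
Qed.
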